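(* The isotropic curvature map $\Psi:\mathcal{M}_{n+1,n}\to C^\infty(\mathbb{R},V_n)$ is onto, and for every $u\in C^\infty(\mathbb{R},V_n)$ the fiber $\Psi^{-1}(u)$ is an orbit of the action of $O(n+1,n)$ on $\mathcal{M}_{n+1,n}$ given by $(A\cdot\gamma)(x)=A\gamma(x)$.
   Context: Let $n\ge 1$, let $e_{i,j}$ be the $(2n+1)\times(2n+1)$ elementary matrices, $C_n=\sum_{i=1}^{2n+1}(-1)^{n+i-1}e_{i,2n+2-i}$, and let $\mathbb{R}^{n+1,n}$ be $\mathbb{R}^{2n+1}$ with the bilinear form $\langle X,Y\rangle=X^tC_nY$. $O(n+1,n)$ is the group of real matrices $A$ with $A^tC_nA=C_n$. Put $b=\sum_{i=1}^{2n}e_{i+1,i}$, $\beta_i=e_{n+1-i,n+i}+e_{n+2-i,n+1+i}$ for $1\le i\le n$, and $V_n=\bigoplus_{i=1}^n\mathbb{R}\beta_i$. A smooth map $\gamma:\mathbb{R}\to\mathbb{R}^{n+1,n}$ is an isotropic curve if $\gamma,\gamma_s,\dots,\gamma_s^{(2n)}$ are linearly independent at every $s$ and the span of $\gamma,\gamma_s,\dots,\gamma_s^{(n-1)}$ is a maximal isotropic subspace for every $s$. $\mathcal{M}_{n+1,n}$ is the set of isotropic curves $\gamma:\mathbb{R}\to\mathbb{R}^{n+1,n}$, $x\mapsto\gamma(x)$, with $\langle\gamma_x^{(n)},\gamma_x^{(n)}\rangle\equiv 1$. For $\gamma\in\mathcal{M}_{n+1,n}$ there is a unique smooth $g:\mathbb{R}\to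 O(n+1,n)$ (the isotropic moving frame) whose $i$-th column is $\gamma_x^{(i-1)}$ for $1\le i\le n+1$ and with $u:=g^{-1}g_x-b\in C^\infty(\mathbb{R},V_n)$; $u$ is called the isotropic curvature of $\gamma$, and $\Psi(\gamma)=u$. *)

(* Defs.v *)
From HB Require Import structures.
From mathcomp Require Import all_boot all_order all_algebra.
From mathcomp Require Import all_classical all_reals all_analysis.

Set Implicit Arguments.
Unset Strict Implicit.
Unset Printing Implicit Defensive.

Import Order.TTheory GRing.Theory Num.Theory.
Import numFieldNormedType.Exports.

Local Open Scope classical_set_scope.
Local Open Scope ring_scope.

Definition smooth (R : realType) (V : normedModType R) (f : R -> V) : Prop :=
  forall (k : nat) (x : R), derivable (derive1n k f) x 1.

Section IsotropicCurves.
Variables (R : realType) (n : nat).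

Local Notation N := (2 * n).+1.

(* The indices i, j run over 1, ..., 2n+1; only such values are used below
   (inord would send larger ones to the first index). *)
Definition elem (i j : nat) : 'M[R]_N := delta_mx (inord i.-1) (inord j.-1).

Definition C_mx : 'M[R]_N :=
  \sum_(1 <= i < (2 * n + 1).+1)
     (-1) ^+ (n + i - 1) *: elem i (2 * n + 2 - i).

Definition form (X Y : 'cV[R]_N) : R := (X^T *m C_mx *m Y) 0 0.

Definition O_group : set 'M[R]_N := [set A | A^T *m C_mx *m A = C_mx].

Definition b_mx : 'M[R]_N := \sum_(1 <= i < (2 * n).+1) elem i.+1 i.

Definition beta (i : nat) : 'M[R]_N :=
  elem (n + 1 - i) (n + i) + elem (n + 2 - i) (n + 1 + i).

Definition V_space : {vspace 'M[R]_N} := (\sum_(1 <= i < n.+1) <[beta i]>)%VS.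

Definition smooth_V : set (R -> 'M[R]_N) :=
  [set u | smooth u /\ forall x, u x \in V_space].

Definition isotropic (W : {vspace 'cV[R]_N}) : Prop :=
  forall X Y, X \in W -> Y \in W -> form X Y = 0.

Definition maximal_isotropic (W : {vspace 'cV[R]_N}) : Prop :=
  isotropic W /\
  forall W' : {vspace 'cV[R]_N}, isotropic W' -> (W <= W')%VS -> W' = W.

Definition isotropic_curve (gamma : R -> 'cV[R]_N) : Prop :=
  [/\ smooth gamma,
      forall s, free (mkseq (fun i => derive1n i gamma s) N) &
      forall s, maximal_isotropic <<mkseq (fun i => derive1n i gamma s) n>>%VS].

Definition M_space : set (R -> 'cV[R]_N) :=
  [set gamma | isotropic_curve gamma /\
     forall x, form (derive1n n gamma x) (derive1n n gamma x) = 1].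

Definition frame_curvature (g : R -> 'M[R]_N) : R -> 'M[R]_N :=
  fun x => invmx (g x) *m derive1 g x - b_mx.

(* Columns are numbered from 0 here: column i is the i-th derivative,
   0 <= i <= n. *)
Definition isotropic_moving_frame
    (gamma : R -> 'cV[R]_N) (g : R -> 'M[R]_N) : Prop :=
  [/\ smooth g,
      forall x, O_group (g x),
      forall (i : 'I_N) x, (i <= n)%N -> col i (g x) = derive1n i gamma x &
      smooth_V (frame_curvature g)].

(* The moving frame of a curve in M_space exists and is unique; the default
   value of xget is only reached for curves without a moving frame. *)
Definition moving_frame (gamma : R -> 'cV[R]_N) : R -> 'M[R]_N :=
  xget (cst 1%:M) (isotropic_moving_frame gamma).

Definition Psi (gamma : R -> 'cV[R]_N) : R -> 'M[R]_N :=
  frame_curvature (moving_frame gamma).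

Definition act (A : 'M[R]_N) (gamma : R -> 'cV[R]_N) : R -> 'cV[R]_N :=
  fun x => A *m gamma x.

Definition O_orbit (gamma : R -> 'cV[R]_N) : set (R -> 'cV[R]_N) :=
  [set act A gamma | A in O_group].

End IsotropicCurves.

(* Main.v *)
Require Import Defs.
From mathcomp Require Import all_boot all_order all_algebra.
From mathcomp Require Import all_classical all_reals all_analysis.
From mathcomp Require Import ring lra zify.

Set Implicit Arguments.
Unset Strict Implicit.
Unset Printing Implicit Defensive.

Import Order.TTheory GRing.Theory Num.Theory.
Import numFieldNormedType.Exports.

Local Open Scope classical_set_scope.
Local Open Scope ring_scope.

(** A moving frame is a solution of the linear equation [g' = g (b + u)] in the
    group [O(n+1,n)], and the curve is its first column. The statement amounts to
    three facts.

    First, this equation can be solved for every smooth [u] with values in [V_n].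
    Linear systems have global solutions on the line ([linear_ode_solution], by
    Picard iteration), and they are smooth when the coefficients are. Since
    [b + u] takes its values in the Lie algebra of [O(n+1,n)] ([curv_mx_skew]), the
    product [g C g^T] is constant along the flow, so the solution starting at the
    identity stays in the group.

    Second, the first column [gamma] of such a [g] belongs to the space of curves
    considered ([framed_curve]): its derivatives of order at most [n] are the next
    columns of [g], and the pairings of all its derivatives with the columns of
    [g] form a triangular matrix, which gives linear independence.

    Third, every curve [gamma] of this space has a moving frame
    ([moving_frame_exists]), and the curvature of such a frame depends on [gamma]
    only ([moving_frame_curvature]). For both, one reads the equation column by
    column. The columns of index 0 to [n] are the derivatives of [gamma]. Each
    further column is the derivative of the previous one, corrected by two
    earlier derivatives of [gamma]; one coefficient is the curvature found at the
    step before, and the other is a new curvature, which is determined by the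
    condition that the new column be null ([null_correction]). The remaining
    scalar products come from differentiating those already known ([gram_step]),
    and the equation of the last column from the antisymmetry of the elements of
    the Lie algebra ([skew_eq]).

    So the curvature map is well defined and onto. If two curves have the same
    curvature [u], their frames [g] and [h] solve the same equation, and
    [h g^-1 = h C g^T C] is then a constant element of the group that maps the one
    curve to the other. Conversely, [A g] solves the same equation as [g]. *)

(** * Linear systems of differential equations *)
Section LinearODE.
Context {R : realType}.

Lemma is_derive_continuous (f : R -> R) (x d : R) :
  is_derive x 1 f d -> {for x, continuous f}.
Proof.
move=> [df _]; exact/differentiable_continuous/derivable1_diffP.
Qed.

(** The functions [p - f] and [p + f] have a nonnegative derivative. *)
Lemma mean_value_bound_right (f df p dp : R -> R) (T : R) : 0 <= T ->
  (forall t : R, 0 <= t <= T -> is_derive t 1 f (df t)) ->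
  (forall t : R, 0 <= t <= T -> is_derive t 1 p (dp t)) ->
  (forall t : R, 0 <= t <= T -> `|df t| <= dp t) ->
  `|f T - f 0| <= p T - p 0.
Proof.
move=> T0 fd pd le.
(* [s] is a sign; the two signs together bound the absolute value. *)
have cst s : s \in [:: -1; 1 : R] -> s * (f T - f 0) <= p T - p 0.
  move=> sE.
  have hd t : 0 <= t <= T ->
      is_derive t 1 (fun t => p t - s * f t) (dp t - s * df t).
    move=> tT; have ? := fd t tT; have ? := pd t tT.
    exact: is_derive_eq.
  have [||c /[!in_itv]/= cT E] := @MVT_segment R (fun t => p t - s * f t)
                     (fun t => dp t - s * df t) 0 T T0.
  - by move=> t /[!in_itv]/= /andP[a b]; apply: hd; rewrite !ltW.
  - apply: continuous_in_subspaceT => t /[!inE]/= /[!in_itv]/= tT.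
    exact: is_derive_continuous (hd t tT).
  rewrite subr0 in E.
  have : 0 <= (dp c - s * df c) * T.
    apply: mulr_ge0 => //; have := le c cT; rewrite ler_norml subr_ge0.
    by move: sE; rewrite !inE => /orP[] /eqP -> /andP[]; lra.
  rewrite -E; lra.
rewrite ler_norml; have := cst (-1); have := cst 1; rewrite !inE !eqxx orbT /=.
move=> /(_ isT) + /(_ isT); lra.
Qed.

(** The two-sided form, with a majorant of [|x|], is what the estimates around
    the initial time [0] need: the half-line [x <= 0] follows by reflection. *)
Lemma mean_value_bound (f df p dp : R -> R) (T : R) :
  (forall t : R, `|t| <= T -> is_derive t 1 f (df t)) ->
  (forall t : R, 0 <= t <= T -> is_derive t 1 p (dp t)) ->
  (forall t : R, `|t| <= T -> `|df t| <= dp `|t|) ->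
  forall x : R, `|x| <= T -> `|f x - f 0| <= p `|x| - p 0.
Proof.
move=> fd pd le x xT.
have [x0|x0] := leP 0 x.
- rewrite (ger0_norm x0); rewrite (ger0_norm x0) in xT.
  apply: (@mean_value_bound_right f df p dp) => // t /andP[t0 tx].
  + by apply: fd; rewrite ger0_norm // (le_trans tx).
  + by apply: pd; rewrite t0 (le_trans tx).
  + by have := le t; rewrite (ger0_norm t0) => -> //; exact: le_trans xT.
- rewrite (ltr0_norm x0); rewrite (ltr0_norm x0) in xT.
  have := @mean_value_bound_right (f \o -%R) (fun t => df (- t) * -1) p dp (- x).
  rewrite /= opprK oppr0; apply.
  + by rewrite oppr_ge0 ltW.
  + move=> t /andP[t0 tx]; apply: is_derive1_comp.
    by apply: fd; rewrite normrN ger0_norm // (le_trans tx).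
  + by move=> t /andP[t0 tx]; apply: pd; rewrite t0 (le_trans tx).
  + move=> t /andP[t0 tx]; rewrite mulrN1 normrN.
    have := le (- t); rewrite normrN (ger0_norm t0); apply; exact: le_trans xT.
Qed.

Lemma zero_derivative_near0 (f : R -> R) (T : R) :
  (forall t : R, `|t| <= T -> is_derive t 1 f 0) ->
  forall x : R, `|x| <= T -> f x = f 0.
Proof.
move=> fd x xT; apply/eqP; rewrite -subr_eq0 -normr_le0.
have := @mean_value_bound f (cst 0) (cst 0) (cst 0) T fd.
by rewrite /= subrr; apply => // t _; rewrite normr0.
Qed.

Lemma primitive_near0 (f : R -> R) (T : R) : continuous f -> 0 < T ->
  exists2 F : R -> R, F 0 = 0 & forall x : R, `|x| < T -> is_derive x 1 F (f x).
Proof.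
move=> cf T0.
pose P x := \int[lebesgue_measure]_(t in `[- T, x]) f t.
exists (fun x => P x - P 0); first by rewrite subrr.
move=> x /[!ltr_norml] /andP[Tx xT].
have [||||dP PE] := @continuous_FTC1_closed R f (- T) x T.
- exact: xT.
- apply: continuous_compact_integrable; first exact: segment_compact.
  exact: continuous_subspaceT.
- exact: Tx.
- exact: cf.
have ? : is_derive x 1 P (f x).
  by rewrite -PE derive1E; exact: derivableP.
by apply: is_derive_eq; rewrite subr0.
Qed.

(** Fundamental theorem of calculus on the whole line. The primitives vanishing
    at [0] that it provides on two bounded intervals agree where both are
    defined, hence the diagonal [x |-> P x x] is locally one of them. *)
Lemma primitive (f : R -> R) : continuous f ->
  exists2 F : R -> R, F 0 = 0 & forall x : R, is_derive x 1 F (f x).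
Proof.
move=> cf.
have pos (T : R) : 0 < `|T| + 1 by rewrite ltr_wpDl.
pose P (T : R) := sval (cid2 (primitive_near0 cf (pos T))).
have P0 T : P T 0 = 0 by rewrite /P; case: cid2.
have PD T (x : R) : `|x| < `|T| + 1 -> is_derive x 1 (P T) (f x).
  by rewrite /P; case: cid2 => F /= _; apply.
have PE S x : `|x| < `|S| + 1 -> P S x = P x x.
  move=> xS; apply/eqP; rewrite -subr_eq0; apply/eqP.
  transitivity (P S 0 - P x 0); last by rewrite !P0 subrr.
  apply: (@zero_derivative_near0 (fun t => P S t - P x t) `|x|) => // t tx.
  have ? := PD S t (le_lt_trans tx xS).
  have ? : is_derive t 1 (P x) (f t).
    by apply: PD; rewrite (le_lt_trans tx) // ltrDl.
  by apply: is_derive_eq; rewrite subrr.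
exists (fun x => P x x); first exact: P0.
move=> x; have xx : `|x| < `| `|x| + 1 | + 1.
  by rewrite (ger0_norm (ltW (pos x))); lra.
apply: near_eq_is_derive (PD _ _ xx).
near=> y; apply/PE; rewrite (ger0_norm (ltW (pos x))).
have : `|x - y| < 1 by near: y; apply: cvgr_dist_lt => //; exact: cvg_id.
have := ler_normB x (x - y); rewrite opprB addrCA subrr addr0; lra.
Unshelve. all: by end_near. Qed.

Lemma geometric_small (C e : R) : 0 < e -> exists k, C / 2 ^+ k < e.
Proof.
move=> e0.
have : geometric C (2^-1) @ \oo --> (0 : R).
  by apply: cvg_geometric; rewrite ger0_norm ?invr_ge0 //; lra.
move=> /cvgr_lt /(_ e e0) [N _ /(_ N (leqnn N))].
by rewrite /geometric /= exprVn; exists N.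
Qed.

(** The rate of convergence depends on [C] only: applied pointwise with a [C] that
    is valid on a whole interval, it gives uniform convergence there. *)
Lemma geometric_cauchy_limit (u : nat -> R) (C : R) :
  (forall k, `|u k.+1 - u k| <= C / 2 ^+ k) ->
  forall k, `|limn u - u k| <= C * 2 / 2 ^+ k.
Proof.
move=> uC.
have C0 : 0 <= C by have := uC 0%N; rewrite expr0 divr1; exact: le_trans.
have tail k m : `|u (k + m)%N - u k| <= C * 2 / 2 ^+ k - C * 2 / 2 ^+ (k + m).
  elim: m => [|m IH]; first by rewrite addn0 !subrr normr0.
  have := uC (k + m)%N; rewrite addnS.
  have -> : C * 2 / 2 ^+ (k + m).+1 = C / 2 ^+ (k + m).
    by rewrite exprS; field; rewrite expf_neq0.
  have := ler_normD (u (k + m).+1 - u (k + m)%N) (u (k + m)%N - u k).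
  rewrite addrA subrK; move: IH.
  (* The bound telescopes: its decrement from [k + m] to [k + m + 1] is the next step. *)
  have -> : C * 2 / 2 ^+ (k + m) = C / 2 ^+ (k + m) + C / 2 ^+ (k + m) by ring.
  lra.
have bnd k l : (k <= l)%N -> `|u l - u k| <= C * 2 / 2 ^+ k.
  move=> kl; rewrite -(subnKC kl); apply: le_trans (tail _ _) _.
  by rewrite gerBl divr_ge0 // ?mulr_ge0 // exprn_ge0.
have cu : cvgn u.
  apply/cauchy_cvgP/cauchy_exP => e e0.
  have [N NE] := @geometric_small (C * 2) e e0.
  exists (u N); exists N => // k /= Nk; rewrite /ball /=.
  by rewrite distrC; exact: le_lt_trans (bnd N k Nk) NE.
move=> k.
have h : `|u l - u k| @[l --> \oo] --> `|limn u - u k|.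
  by apply: cvg_norm; apply: cvgB => //; exact: cvg_cst.
rewrite -(cvg_lim _ h) //; apply: limr_le; first exact: cvgP h.
by near=> l; apply: bnd; near: l; exact: nbhs_infty_ge.
Unshelve. all: by end_near. Qed.

(** Choosing a primitive of each continuous function makes the Picard operator
    a plain function. *)
Definition primitive_of (f : R -> R) : R -> R :=
  xget (cst 0) [set F : R -> R | F 0 = 0 /\ forall x : R, is_derive x 1 F (f x)].

Lemma primitive_ofP (f : R -> R) : continuous f ->
  primitive_of f 0 = 0 /\ forall x : R, is_derive x 1 (primitive_of f) (f x).
Proof.
move=> /primitive[F F0 FD].
exact: (@xgetPex _ (cst 0)
  [set F : R -> R | F 0 = 0 /\ forall x : R, is_derive x 1 F (f x)]) (ex_intro _ F (conj F0 FD)).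
Qed.

(** The primitive of [K exp (2 K t)] is half of [exp (2 K t)]. So in the norm
    weighted by [exp (- 2 K |t|)] the Picard operator is a contraction of ratio
    [1/2] on every bounded interval, however long. *)
Lemma exp_weighted_bound (D dD : R -> R) (K B T : R) : 0 <= B -> D 0 = 0 ->
  (forall t : R, `|t| <= T -> is_derive t 1 D (dD t)) ->
  (forall t : R, `|t| <= T -> `|dD t| <= K * B * expR (2 * K * `|t|)) ->
  forall x : R, `|x| <= T -> `|D x| <= B / 2 * expR (2 * K * `|x|).
Proof.
move=> B0 D0 DD dDB x xT.
pose p t := B / 2 * expR (2 * K * t).
have pd (t : R) : 0 <= t <= T -> is_derive t 1 p (K * B * expR (2 * K * t)).
  move=> _; have h : is_derive t 1 (fun t => 2 * K * t) (2 * K).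
    by apply: is_derive_eq; rewrite /GRing.scale /= mulr1.
  have h2 := @is_derive1_comp _ expR (fun t => 2 * K * t) t _ _ (is_derive_expR _) h.
  by apply: is_derive_eq; rewrite /GRing.scale /=; field.
have := mean_value_bound DD pd dDB xT.
by rewrite D0 subr0 /p mulr0 expR0 mulr1; lra.
Qed.

Lemma continuous_sum (I : Type) (r : seq I) (P : pred I) (f : I -> R -> R) :
  (forall i, P i -> continuous (f i)) ->
  continuous (fun x => \sum_(i <- r | P i) f i x).
Proof. by move=> fc; apply: continuous_big => //; exact: add_continuous. Qed.

(** The system [f_i' = sum_j a_ij f_j], [f_i 0 = c_i]. *)
Section Picard.
Variables (m : nat) (a : 'I_m -> 'I_m -> R -> R) (c : 'I_m -> R).
Hypothesis a_cont : forall i j, continuous (a i j).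

Fixpoint picard (k : nat) : 'I_m -> R -> R :=
  if k is k'.+1 then
    fun i x => c i + primitive_of (fun t => \sum_j a i j t * picard k' j t) x
  else fun i => cst (c i).

Let rhs_continuous (f : 'I_m -> R -> R) i : (forall j, continuous (f j)) ->
  continuous (fun t => \sum_j a i j t * f j t).
Proof.
move=> fc; apply: continuous_sum => j _ x.
by apply: cvgM; [exact: a_cont | exact: fc].
Qed.

Let picard_spec k : (forall i, continuous (picard k i)) /\
  forall i, picard k.+1 i 0 = c i /\ forall x : R,
    is_derive x 1 (picard k.+1 i) (\sum_j a i j x * picard k j x).
Proof.
have main k' : (forall i, continuous (picard k' i)) ->
  forall i, picard k'.+1 i 0 = c i /\ forall x : R,
    is_derive x 1 (picard k'.+1 i) (\sum_j a i j x * picard k' j x).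
  move=> pc i; have [p0 pd] := primitive_ofP (rhs_continuous (i := i) pc).
  split=> [|x]; first by rewrite /= p0 addr0.
  by have ? := pd x; rewrite /=; apply: is_derive_eq; rewrite add0r mul1r.
elim: k => [|k [pc pd]]; last first.
  have pc' : forall i, continuous (picard k.+1 i).
    by move=> i x; have [_ /(_ x)] := pd i; exact: is_derive_continuous.
  by split => //; exact: main.
have pc : forall i, continuous (picard 0 i) by move=> i x; exact: cvg_cst.
by split => //; exact: main.
Qed.

(** As [K] serves the maximum, over the times [|x| <= T], of the sum of the
    absolute values of all the coefficients. *)
Let coef_bound (T : R) : 0 <= T -> exists2 K : R, 0 <= K &
  forall (x : R) (v : 'I_m -> R) (B : R) i, `|x| <= T ->
    (forall j, `|v j| <= B) -> `|\sum_j a i j x * v j| <= K * B.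
Proof.
move=> T0; pose s (t : R) : R := \sum_i \sum_j `|a i j t|.
have sc : continuous s.
  apply: continuous_sum => i _; apply: continuous_sum => j _ x.
  by apply: cvg_norm; exact: a_cont.
have [|d _ dmax] := @EVT_max R s (- T) T _ (continuous_subspaceT sc).
  by lra.
have s0 t : 0 <= s t by apply: sumr_ge0 => i _; exact: sumr_ge0.
exists (s d) => // x v B i xT vB.
have le : \sum_j `|a i j x| <= s d.
  apply: le_trans (dmax x _); last by rewrite in_itv /= -ler_norml.
  by rewrite /s [leRHS](bigD1 i) //= lerDl; apply: sumr_ge0 => ? _; exact: sumr_ge0.
apply: le_trans (ler_norm_sum _ _ _) _.
apply: (@le_trans _ _ (\sum_j `|a i j x| * B)).
  by apply: ler_sum => j _; rewrite normrM ler_wpM2l.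
rewrite -mulr_suml; have [B0|B0] := leP 0 B; first by rewrite ler_wpM2r.
have [j|m0] := pickP 'I_m; first by have := vB j; have := normr_ge0 (v j); lra.
by have := m0 i.
Qed.

Let picard_lim i (x : R) : R := limn (fun k => picard k i x).

(** The contraction makes successive iterates approach each other geometrically,
    at a rate that is uniform over the times [|x| <= T]. *)
Let picard_approx (T : R) : 0 <= T -> exists E : R, forall k i (x : R), `|x| <= T ->
  `|picard_lim i x - picard k i x| <= E / 2 ^+ k.
Proof.
move=> T0; have [K K0 KB] := coef_bound T0.
pose B0 : R := \sum_i `|c i|.
have B00 : 0 <= B0 by exact: sumr_ge0.
have step k i (x : R) : `|x| <= T ->
    `|picard k.+1 i x - picard k i x| <= B0 / 2 / 2 ^+ k * expR (2 * K * `|x|).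
  elim: k i x => [|k IH] i x xT.
    have [_ /(_ i) [p0 pd]] := picard_spec 0.
    rewrite expr0 divr1.
    apply: (@exp_weighted_bound (fun x => picard 1 i x - picard 0 i x)
              (fun x => \sum_j a i j x * c j) K B0 T) => //.
    - by rewrite p0 subrr.
    - by move=> t _; have ? := pd t; apply: is_derive_eq; rewrite subr0.
    - move=> t tT; apply: (@le_trans _ _ (K * B0)); last first.
        by rewrite ler_peMr ?mulr_ge0 // -expR0 ler_expR !mulr_ge0.
      by apply: KB => // j; rewrite /B0 [leRHS](bigD1 j) //= lerDl sumr_ge0.
  have [_ /(_ i) [p0 pd]] := picard_spec k.
  have [_ /(_ i) [q0 qd]] := picard_spec k.+1.
  have -> : B0 / 2 / 2 ^+ k.+1 = B0 / 2 / 2 ^+ k / 2.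
    by rewrite exprSr invfM mulrA.
  apply: (@exp_weighted_bound (fun x => picard k.+2 i x - picard k.+1 i x)
      (fun x => \sum_j a i j x * (picard k.+1 j x - picard k j x)) K _ T) => //.
  - by rewrite !divr_ge0 // exprn_ge0.
  - by rewrite p0 q0 subrr.
  - move=> t _; have ? := pd t; have ? := qd t; apply: is_derive_eq.
    by rewrite -sumrB; apply: eq_bigr => j _; rewrite mulrBr.
  - by move=> t tT; rewrite -mulrA; apply: KB => // j; exact: IH.
exists (B0 / 2 * expR (2 * K * T) * 2) => k i x xT.
apply: (@geometric_cauchy_limit (fun k => picard k i x)) => l.
apply: le_trans (step l i x xT) _.
rewrite [leRHS]mulrAC ler_wpM2l ?divr_ge0 // ?exprn_ge0 //.
by rewrite ler_expR ler_wpM2l // mulr_ge0.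
Qed.

Let picard_lim_continuous i : continuous (picard_lim i).
Proof.
move=> x; have [E hE] : exists E : R, forall k i (y : R), `|y| <= `|x| + 1 ->
    `|picard_lim i y - picard k i y| <= E / 2 ^+ k.
  by apply: picard_approx; rewrite addr_ge0.
apply/cvgrPdist_lt => e e0.
have [k kE] : exists k, E / 2 ^+ k < e / 3 by apply: geometric_small; lra.
have [pc _] := picard_spec k.
near=> y.
have y1 : `|x - y| < 1 by near: y; apply: cvgr_dist_lt => //; exact: cvg_id.
have p : `|picard k i x - picard k i y| < e / 3.
  by near: y; apply: cvgr_dist_lt; [exact: pc | rewrite divr_gt0].
have hx : `|picard_lim i x - picard k i x| <= E / 2 ^+ k by apply: hE; lra.
have hy : `|picard_lim i y - picard k i y| <= E / 2 ^+ k.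
  apply: hE; have := ler_normB x (x - y); rewrite opprB addrCA subrr addr0; lra.
move: hx hy p; rewrite !ler_norml !ltr_norml => /andP[? ?] /andP[? ?] /andP[? ?].
apply/andP; split; lra.
Unshelve. all: by end_near. Qed.

(** The limit [f] of the iterates is continuous, so that [sum_j a_ij f_j] has a
    primitive [F_i]. The derivatives of the iterates converge to it uniformly on
    bounded intervals, which forces [f_i = c_i + F_i]. *)
Theorem linear_ode_solution : exists f : 'I_m -> R -> R,
  forall i, f i 0 = c i /\
    forall x : R, is_derive x 1 (f i) (\sum_j a i j x * f j x).
Proof.
have pl i := primitive_ofP (rhs_continuous (i := i) picard_lim_continuous).
pose F i := primitive_of (fun t => \sum_j a i j t * picard_lim j t).
have limE i (x : R) : picard_lim i x = c i + F i x.
  apply/eqP; rewrite -subr_eq0 -normr_le0; apply/ler_addgt0Pl => e e0; rewrite addr0.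
  have [E hE] := picard_approx (normr_ge0 x).
  have [K K0 KB] := coef_bound (normr_ge0 x).
  have E0 : 0 <= E by have := hE 0%N i x (lexx _); rewrite expr0 divr1; exact: le_trans.
  have [k kE] := @geometric_small (E + K * E * `|x|) e e0.
  have [pc /(_ i) [p0 pd]] := picard_spec k; have [F0 FD] := pl i.
  have := @mean_value_bound (fun t => picard k.+1 i t - F i t)
    (fun t => \sum_j a i j t * (picard k j t - picard_lim j t))
    (fun t => K * (E / 2 ^+ k) * t) (fun=> K * (E / 2 ^+ k)) `|x| _ _ _ x (lexx _).
  rewrite p0 [F i 0]F0 subr0 mulr0 subr0 => H.
  have h1 : `|picard k.+1 i x - F i x - c i| <= K * (E / 2 ^+ k) * `|x|.
    apply: H => //.
    - move=> t _; have ? := pd t; have ? := FD t; apply: is_derive_eq.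
      by rewrite -sumrB; apply: eq_bigr => j _; rewrite mulrBr.
    - by move=> t _; apply: is_derive_eq; rewrite /GRing.scale /= mulr1.
    - by move=> t tx; apply: KB => // j; rewrite distrC; exact: hE.
  have h2 : `|picard_lim i x - picard k.+1 i x| <= E / 2 ^+ k.
    apply: le_trans (hE k.+1 i x (lexx _)) _.
    rewrite ler_wpM2l // lef_pV2 ?posrE ?exprn_gt0 // exprS ler_peMl //.
    by rewrite ler1n.
  apply: le_trans (ltW kE).
  rewrite mulrDl; have -> : K * E * `|x| / 2 ^+ k = K * (E / 2 ^+ k) * `|x| by ring.
  move: h1 h2; move: (K * _ * _) => M; rewrite !ler_norml => /andP[? ?] /andP[? ?].
  by apply/andP; split; lra.
exists picard_lim => i; have [F0 FD] := pl i; split; first by rewrite limE [F i 0]F0 addr0.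
move=> x; have -> : picard_lim i = fun x => c i + F i x by apply/funext => t; exact: limE.
have ? := FD x; apply: is_derive_eq; rewrite add0r mul1r.
by apply: eq_bigr => j _; rewrite limE.
Qed.

End Picard.
End LinearODE.

(** * Calculus of smooth matrix-valued functions *)
Section MatrixCalculus.
Context {R : realType}.

Lemma derive1_val (V : normedModType R) (f : R -> V) (x : R) (d : V) :
  is_derive x 1 f d -> derive1 f x = d.
Proof. by move=> fd; rewrite derive1E derive_val. Qed.

Lemma derive1_is_derive (V : normedModType R) (f : R -> V) (x : R) :
  derivable f x 1 -> is_derive x 1 f (derive1 f x).
Proof. by move=> fd; rewrite derive1E; exact: derivableP. Qed.

Lemma is_derive_mxP m n (F : R -> 'M[R]_(m, n)) (x : R) D :
  is_derive x 1 F D <-> forall i j, is_derive x 1 (fun t => F t i j) (D i j).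
Proof.
split=> [FD i j|FD].
  have [/derivable_mxP Fx E] := FD.
  apply: DeriveDef; first exact: Fx.
  by rewrite -E derive_mx ?mxE //; case: FD.
have Fx : derivable F x 1 by apply/derivable_mxP => i j; case: (FD i j).
apply: DeriveDef => //; rewrite derive_mx //; apply/matrixP => i j.
by rewrite mxE; case: (FD i j).
Qed.

Lemma is_derive_bigsum n (f : 'I_n -> R -> R) (df : 'I_n -> R) (x : R) :
  (forall i, is_derive x 1 (f i) (df i)) ->
  is_derive x 1 (fun t => \sum_i f i t) (\sum_i df i).
Proof.
move=> fd; have := is_derive_sum fd.
by rewrite (_ : \sum_i f i = fun t => \sum_i f i t) // -fct_sumE.
Qed.

Lemma is_derive_mulmx m n p (F : R -> 'M[R]_(m, n)) (G : R -> 'M[R]_(n, p))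
    (x : R) dF dG : is_derive x 1 F dF -> is_derive x 1 G dG ->
  is_derive x 1 (fun t => F t *m G t) (dF *m G x + F x *m dG).
Proof.
move=> /is_derive_mxP FD /is_derive_mxP GD; apply/is_derive_mxP => i j.
rewrite (_ : (fun t => _) = fun t => \sum_k F t i k * G t k j); last first.
  by apply/funext => t; rewrite mxE.
rewrite !mxE -big_split /=; apply: is_derive_bigsum => k.
have ? := FD i k; have ? := GD k j.
by apply: is_derive_eq; rewrite /GRing.scale /=; ring.
Qed.

Lemma is_derive_trmx m n (F : R -> 'M[R]_(m, n)) (x : R) dF :
  is_derive x 1 F dF -> is_derive x 1 (fun t => (F t)^T) dF^T.
Proof.
move=> /is_derive_mxP FD; apply/is_derive_mxP => i j.
rewrite mxE (_ : (fun t => _) = fun t => F t j i) //.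
by apply/funext => t; rewrite mxE.
Qed.

Lemma zero_derivative_mx m n (F : R -> 'M[R]_(m, n)) :
  (forall x : R, is_derive x 1 F 0) -> forall x y, F x = F y.
Proof.
move=> FD x y; apply/matrixP => i j.
apply: (@is_derive_0_is_cst _ (fun t => F t i j)) => t.
by have /is_derive_mxP/(_ i j) := FD t; rewrite mxE.
Qed.

(** The rows of [G' = G M] are independent systems with the coefficients [M^T]. *)
Lemma linear_matrix_ode n (M : R -> 'M[R]_n) (G0 : 'M[R]_n) :
  (forall i j, continuous (fun t => M t i j)) ->
  exists G : R -> 'M[R]_n, G 0 = G0 /\
    forall x : R, is_derive x 1 G (G x *m M x).
Proof.
move=> Mc.
have sol i := @linear_ode_solution R n (fun j l t => M t l j) (G0 i) (fun j l => Mc l j).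
pose f i := sval (cid (sol i)).
have fP i j : f i j 0 = G0 i j /\
    forall x : R, is_derive x 1 (f i j) (\sum_l M x l j * f i l x).
  by rewrite /f; case: cid => /= g; apply.
exists (fun x => \matrix_(i, j) f i j x); split.
  by apply/matrixP => i j; rewrite mxE; have [] := fP i j.
move=> x; apply/is_derive_mxP => i j.
rewrite (_ : (fun t => _) = f i j); last by apply/funext => t; rewrite mxE.
have [_ /(_ x)] := fP i j; congr is_derive; rewrite mxE.
by apply: eq_bigr => l _; rewrite mxE mulrC.
Qed.

(** Smoothness truncated at a finite order, so that closure under products and
    the regularity of solutions can be proved by induction on the order. *)
Definition derivable_upto (V : normedModType R) (k : nat) (f : R -> V) : Prop :=
  forall l, (l < k)%N -> forall x : R, derivable (derive1n l f) x 1.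

Lemma derivable_upto0 (V : normedModType R) (f : R -> V) : derivable_upto 0 f.
Proof. by move=> l; rewrite ltn0. Qed.

Lemma smooth_upto (V : normedModType R) (f : R -> V) :
  smooth f <-> forall k, derivable_upto k f.
Proof.
split=> [fs k l _ x|fs k x]; first exact: fs.
by apply: (fs k.+1 k).
Qed.

Lemma derivable_uptoS (V : normedModType R) k (f : R -> V) :
  derivable_upto k.+1 f <->
  (forall x : R, derivable f x 1) /\ derivable_upto k (derive1 f).
Proof.
split=> [fk|[f0 fk] [|l] lk x].
- split=> [x|l lk x]; first exact: (fk 0%N).
  by rewrite -derive1Sn; apply: fk.
- exact: f0.
- by rewrite derive1Sn; apply: fk.
Qed.

Lemma derivable_upto_le (V : normedModType R) k l (f : R -> V) : (k <= l)%N ->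
  derivable_upto l f -> derivable_upto k f.
Proof. by move=> kl fl i ik; apply: fl; exact: leq_trans kl. Qed.

Lemma smooth_derivable (V : normedModType R) (f : R -> V) (x : R) :
  smooth f -> derivable f x 1.
Proof. by move=> /(_ 0%N). Qed.

Lemma smooth_is_derive (V : normedModType R) (f : R -> V) (x : R) :
  smooth f -> is_derive x 1 f (derive1 f x).
Proof. by move=> fs; apply/derive1_is_derive/smooth_derivable. Qed.

Lemma smooth_derive1 (V : normedModType R) (f : R -> V) :
  smooth f -> smooth (derive1 f).
Proof. by move=> fs k x; rewrite -derive1Sn; exact: fs. Qed.

Lemma smooth_derive1n (V : normedModType R) (f : R -> V) k :
  smooth f -> smooth (derive1n k f).
Proof.
by elim: k => [//|k IH] fs; rewrite derive1nS; exact/smooth_derive1/IH.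
Qed.

Lemma smooth_continuous (f : R -> R) : smooth f -> continuous f.
Proof. by move=> fs x; apply: is_derive_continuous; exact: smooth_is_derive. Qed.

Lemma derivable_upto_cst (V : normedModType R) k (v : V) :
  derivable_upto k (fun _ : R => v).
Proof.
elim: k v => [|k IH] v; first exact: derivable_upto0.
apply/derivable_uptoS; split=> [x|].
  exact: derivable_cst.
rewrite (_ : derive1 _ = fun=> 0); first exact: IH.
by apply/funext => x; rewrite derive1_cst.
Qed.

Lemma derivable_uptoD k (f g : R -> R) : derivable_upto k f ->
  derivable_upto k g -> derivable_upto k (fun x => f x + g x).
Proof.
elim: k f g => [|k IH] f g; first by move=> _ _; exact: derivable_upto0.
move=> /derivable_uptoS[f0 fk] /derivable_uptoS[g0 gk].
have fgD (x : R) : is_derive x 1 (fun x => f x + g x) (derive1 f x + derive1 g x).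
  have ? := derive1_is_derive (f0 x); have ? := derive1_is_derive (g0 x).
  exact: is_deriveD.
apply/derivable_uptoS; split=> [x|]; first by case: (fgD x).
by rewrite (_ : derive1 _ = fun x => derive1 f x + derive1 g x);
  [exact: IH | apply/funext => x; exact: derive1_val].
Qed.

(** The induction has to go through sums as well: the derivative of a product is
    a sum of two products of the previous order. *)
Lemma derivable_uptoM k (f g : R -> R) : derivable_upto k f ->
  derivable_upto k g -> derivable_upto k (fun x => f x * g x).
Proof.
elim: k f g => [|k IH] f g; first by move=> _ _; exact: derivable_upto0.
move=> fS gS.
have fk := derivable_upto_le (leqnSn k) fS.
have gk := derivable_upto_le (leqnSn k) gS.
move: fS gS => /derivable_uptoS[f0 f'k] /derivable_uptoS[g0 g'k].
have fgD (x : R) : is_derive x 1 (fun x => f x * g x)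
    (f x * derive1 g x + g x * derive1 f x).
  have ? := derive1_is_derive (f0 x); have ? := derive1_is_derive (g0 x).
  exact: is_deriveM.
apply/derivable_uptoS; split=> [x|]; first by case: (fgD x).
rewrite (_ : derive1 _ = fun x => f x * derive1 g x + g x * derive1 f x).
  by apply: derivable_uptoD; exact: IH.
by apply/funext => x; exact: derive1_val.
Qed.

Lemma derivable_upto_sum k n (f : 'I_n -> R -> R) :
  (forall i, derivable_upto k (f i)) ->
  derivable_upto k (fun x => \sum_i f i x).
Proof.
elim: n f => [|n IH] f fk.
  rewrite (_ : (fun x => _) = fun=> 0); first exact: derivable_upto_cst.
  by apply/funext => x; rewrite big_ord0.
rewrite (_ : (fun x => _) = fun x => f ord0 x + \sum_i f (lift ord0 i) x).
  by apply: derivable_uptoD => //; exact: IH.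
by apply/funext => x; rewrite big_ord_recl.
Qed.

Lemma derivable_upto_mxP k m n (F : R -> 'M[R]_(m, n)) :
  derivable_upto k F <-> forall i j, derivable_upto k (fun t => F t i j).
Proof.
elim: k F => [|k IH] F.
  by split=> _; [move=> i j|]; exact: derivable_upto0.
have E i j : (forall x : R, derivable F x 1) ->
    (fun t => derive1 F t i j) = derive1 (fun t => F t i j).
  move=> F0; apply/funext => x.
  have /is_derive_mxP/(_ i j) := derive1_is_derive (F0 x).
  by move=> /derive1_val.
rewrite derivable_uptoS; split=> [[F0 Fk] i j|Fk].
  apply/derivable_uptoS; split=> [x|].
    by have /derivable_mxP := F0 x; exact.
  by rewrite -E //; move/IH: Fk; exact.
have F0 (x : R) : derivable F x 1.
  by apply/derivable_mxP => i j; have /derivable_uptoS[] := Fk i j.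
split=> //; apply/IH => i j; rewrite E //.
by have /derivable_uptoS[] := Fk i j.
Qed.

Lemma smooth_mxP m n (F : R -> 'M[R]_(m, n)) :
  smooth F <-> forall i j, smooth (fun t => F t i j).
Proof.
split=> [Fs i j|Fs].
  apply/smooth_upto => k; move/smooth_upto: Fs => /(_ k).
  by move/derivable_upto_mxP.
apply/smooth_upto => k; apply/derivable_upto_mxP => i j.
by have /smooth_upto := Fs i j.
Qed.

Lemma smooth_cst (V : normedModType R) (v : V) : smooth (fun _ : R => v).
Proof. by apply/smooth_upto => k; exact: derivable_upto_cst. Qed.

Lemma smoothD (f g : R -> R) :
  smooth f -> smooth g -> smooth (fun x => f x + g x).
Proof.
by move=> /smooth_upto fs /smooth_upto gs; apply/smooth_upto => k; exact: derivable_uptoD.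
Qed.

Lemma smoothM (f g : R -> R) :
  smooth f -> smooth g -> smooth (fun x => f x * g x).
Proof.
by move=> /smooth_upto fs /smooth_upto gs; apply/smooth_upto => k; exact: derivable_uptoM.
Qed.

Lemma smooth_sum n (f : 'I_n -> R -> R) :
  (forall i, smooth (f i)) -> smooth (fun x => \sum_i f i x).
Proof.
move=> fs; apply/smooth_upto => k; apply: derivable_upto_sum => i.
by have /smooth_upto := fs i.
Qed.

Lemma smooth_mulmx m n p (F : R -> 'M[R]_(m, n)) (G : R -> 'M[R]_(n, p)) :
  smooth F -> smooth G -> smooth (fun x => F x *m G x).
Proof.
move=> /smooth_mxP Fs /smooth_mxP Gs; apply/smooth_mxP => i j.
rewrite (_ : (fun t => _) = fun t => \sum_k F t i k * G t k j); last first.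
  by apply/funext => t; rewrite mxE.
by apply: smooth_sum => k; exact: smoothM.
Qed.

Lemma smooth_addmx m n (F G : R -> 'M[R]_(m, n)) :
  smooth F -> smooth G -> smooth (fun x => F x + G x).
Proof.
move=> /smooth_mxP Fs /smooth_mxP Gs; apply/smooth_mxP => i j.
rewrite (_ : (fun t => _) = fun t => F t i j + G t i j); last first.
  by apply/funext => t; rewrite mxE.
exact: smoothD.
Qed.

Lemma smooth_scalemx m n (f : R -> R) (G : R -> 'M[R]_(m, n)) :
  smooth f -> smooth G -> smooth (fun x => f x *: G x).
Proof.
move=> fs /smooth_mxP Gs; apply/smooth_mxP => i j.
rewrite (_ : (fun t => _) = fun t => f t * G t i j); last first.
  by apply/funext => t; rewrite mxE.
by apply: (smoothM fs); exact: Gs.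
Qed.

Lemma smooth_trmx m n (F : R -> 'M[R]_(m, n)) :
  smooth F -> smooth (fun x => (F x)^T).
Proof.
move=> /smooth_mxP Fs; apply/smooth_mxP => i j.
by rewrite (_ : (fun t => _) = fun t => F t j i) //; apply/funext => t; rewrite mxE.
Qed.

(** If [G] has [k] derivatives then so has [G' = G M]. *)
Lemma smooth_ode_solution n (G M : R -> 'M[R]_n) : smooth M ->
  (forall x : R, is_derive x 1 G (G x *m M x)) -> smooth G.
Proof.
move=> /smooth_mxP Ms GD; apply/smooth_upto; elim=> [|k IH]; first exact: derivable_upto0.
apply/derivable_uptoS; split=> [x|]; first by case: (GD x).
rewrite (_ : derive1 G = fun x => G x *m M x); last first.
  by apply/funext => x; exact: derive1_val.
apply/derivable_upto_mxP => i j.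
rewrite (_ : (fun t => _) = fun t => \sum_k G t i k * M t k j); last first.
  by apply/funext => t; rewrite mxE.
apply: derivable_upto_sum => l; apply: derivable_uptoM.
  by move/derivable_upto_mxP: IH.
by have /smooth_upto := Ms l j.
Qed.

End MatrixCalculus.

(** * The matrices C_n, b and the space V_n *)
Section CurvatureMatrices.
Variables (R : realType) (n : nat).

Local Notation N := (2 * n).+1.
Local Notation C := (@C_mx R n).
Local Notation b := (@b_mx R n).
Local Notation V := (@V_space R n).

(** Each band of the matrices below has at most one entry in a given column, so
    that the sums defining them and the products with them reduce to one term. *)
Lemma sum_indicator m (F : nat -> R) (P : nat -> bool) (Q : bool) (k0 : nat) :
  (forall k, (k < m)%N -> P k = Q && (k == k0)) -> (Q -> (k0 < m)%N) ->
  \sum_(k < m) F k * (P k)%:R = Q%:R * F k0.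
Proof.
move=> PQ Qk0; case: Q PQ Qk0 => [PQ /(_ isT) k0m|PQ _].
  rewrite (bigD1 (Ordinal k0m)) //= PQ // eqxx mulr1 mul1r big1 ?addr0 // => i ne.
  by rewrite PQ // (_ : _ == _ = false) ?mulr0 //; apply/negbTE.
by rewrite big1 ?mul0r // => i _; rewrite PQ // mulr0.
Qed.

Lemma elemE p q (i j : 'I_N) : (0 < p <= N)%N -> (0 < q <= N)%N ->
  @elem R n p q i j = ((i.+1 == p) && (j.+1 == q))%:R.
Proof.
move=> /andP[p0 pN] /andP[q0 qN]; rewrite mxE -!val_eqE /= !inordK; [|lia..].
by congr ((_ && _)%:R); apply/eqP/eqP; lia.
Qed.

Lemma C_mxE (i j : 'I_N) : C i j = (i + j == 2 * n)%N%:R * (-1) ^+ (n + i).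
Proof.
rewrite /C_mx big_add1 /= big_mkord addn1 summxE.
rewrite (eq_bigr (fun k : 'I_N => (-1) ^+ (n + k) *
    ((i == k :> nat) && (j + k == 2 * n)%N)%:R)) => [|k _]; last first.
  have kN := ltn_ord k; have jN := ltn_ord j.
  rewrite mxE elemE; [|lia..].
  by congr (_ ^+ _ * (_ && _)%:R); [lia|apply/eqP/eqP; lia].
rewrite (sum_indicator (k0 := i) (fun k => (-1) ^+ (n + k))
  (P := fun k => (i == k :> nat) && (j + k == 2 * n)%N) (Q := (i + j == 2 * n)%N)) //.
move=> k kN; rewrite [RHS]andbC (eq_sym k).
by case: eqP => //= <-; rewrite addnC.
Qed.

Lemma b_mxE (i j : 'I_N) : b i j = (i == j.+1 :> nat)%:R.
Proof.
rewrite /b_mx big_add1 /= big_mkord summxE.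
have iN := ltn_ord i; have jN := ltn_ord j.
rewrite (eq_bigr (fun k : 'I_(2 * n) => 1 *
    ((i == k.+1 :> nat) && (j == k :> nat))%:R)) => [|k _]; last first.
  have kN := ltn_ord k; rewrite mul1r elemE; [|lia..].
  by congr ((_ && _)%:R); apply/eqP/eqP; lia.
rewrite (sum_indicator (k0 := j) (fun=> 1)
  (P := fun k => (i == k.+1 :> nat) && (j == k :> nat)) (Q := (i == j.+1 :> nat))).
- by rewrite mulr1.
- move=> k _; rewrite (eq_sym k); case: (_ =P k) => [->|_]; last by rewrite !andbF.
  by rewrite !andbT.
- by move=> /eqP; lia.
Qed.

(** With rows and columns numbered from 0, and for [a] supported as below, this
    is the sum over [i] of [a (n + i - 1) beta_i]: the first term is the upper
    left entry of [beta_i], in column [n + i - 1], and the second is its lower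
    right entry, one column further. The columns themselves index [a], so that
    the equations of a moving frame take the same form for all columns. *)
Definition curv_mx (a : nat -> R) : 'M[R]_N :=
  \matrix_(i, j) ((i + j + 1 == 2 * n)%N%:R * a j + (i + j == 2 * n + 1)%N%:R * a j.-1).

(** The columns that carry the first entry of some [beta_i]. *)
Definition supported (a : nat -> R) : Prop :=
  forall j, ~~ (n <= j < 2 * n)%N -> a j = 0.

Lemma V_spaceP u : u \in V <-> exists2 a, supported a & u = curv_mx a.
Proof.
have sumE (f : nat -> R) :
    \sum_(k < n) f k *: @beta R n k.+1 =
    curv_mx (fun j => (n <= j < 2 * n)%N%:R * f (j - n)%N).
  apply/matrixP => i j; rewrite summxE !mxE.
  have iN := ltn_ord i; have jN := ltn_ord j.
  rewrite (eq_bigr (fun k : 'I_n =>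
      f k * ((i + k + 1 == n)%N && (j == n + k :> nat))%:R +
      f k * ((i + k == n)%N && (j == n + k + 1 :> nat))%:R)) => [|k _]; last first.
    have kn := ltn_ord k; rewrite mxE mxE !elemE; [|lia..].
    by rewrite mulrDr; congr (_ * (_ && _)%:R + _ * (_ && _)%:R); apply/eqP/eqP; lia.
  rewrite big_split /=; congr (_ + _).
    rewrite (sum_indicator (k0 := j - n) f
      (P := fun k => (i + k + 1 == n)%N && (j == n + k :> nat))
      (Q := (i + j + 1 == 2 * n)%N && (n <= j < 2 * n)%N)).
    - by rewrite mulrA -natrM mulnb.
    - by move=> k kn; apply/idP/idP; lia.
    - by lia.
  rewrite (sum_indicator (k0 := j.-1 - n) f
      (P := fun k => (i + k == n)%N && (j == n + k + 1 :> nat))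
      (Q := (i + j == 2 * n + 1)%N && (n <= j.-1 < 2 * n)%N)).
  - by rewrite mulrA -natrM mulnb.
  - by move=> k kn; apply/idP/idP; lia.
  - by lia.
split=> [|[a a0 ->]].
  rewrite /V_space big_add1 /= big_mkord => /memv_sumP[v vV ->].
  have coef (k : 'I_n) : exists c : R, v k = c *: @beta R n k.+1.
    by have /vlineP := vV k isT.
  pose f (k : nat) : R := if insub k is Some k' then sval (cid (coef k')) else 0.
  exists (fun j => (n <= j < 2 * n)%N%:R * f (j - n)%N).
    by move=> j /negbTE ->; rewrite mul0r.
  rewrite -sumE; apply: eq_bigr => k _.
  by rewrite /f valK; case: cid.
rewrite (_ : curv_mx a = \sum_(k < n) a (n + k)%N *: @beta R n k.+1).
  rewrite /V_space big_add1 /= big_mkord.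
  by apply: memv_sumr => k _; apply/vlineP; exists (a (n + k)%N).
rewrite (sumE (fun k => a (n + k)%N)); congr curv_mx; apply/funext => j.
case: (boolP (n <= j < 2 * n)%N) => [/andP[nj _]|/a0 ->]; last by rewrite mul0r.
by rewrite mul1r subnKC.
Qed.

Lemma C_mx_sym : C^T = C.
Proof.
apply/matrixP => i j; rewrite mxE !C_mxE addnC.
case: eqP => [E|_]; last by rewrite !mul0r.
by rewrite !mul1r -signr_odd -[RHS]signr_odd; congr (_ ^+ nat_of_bool _); lia.
Qed.

Lemma C_mx_mul (m : nat) (A : 'M[R]_(N, m)) (i : 'I_N) j :
  (C *m A) i j = (-1) ^+ (n + i) * A (rev_ord i) j.
Proof.
have iN := ltn_ord i.
rewrite mxE (bigD1 (rev_ord i)) //= C_mxE (_ : (i + _ == _)%N) /=; last first.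
  by apply/eqP; rewrite /=; lia.
rewrite mul1r big1 ?addr0 // => k; rewrite -val_eqE /= => ki.
by rewrite C_mxE (_ : (i + k == _)%N = false) ?mul0r //; lia.
Qed.

Lemma C_mx_invol : C *m C = 1%:M.
Proof.
apply/matrixP => i j; rewrite C_mx_mul C_mxE mxE /=.
have iN := ltn_ord i; have jN := ltn_ord j.
rewrite -val_eqE /= (_ : (_ + j == 2 * n)%N = (i == j :> nat)); last by lia.
case: eqP => [E|_]; last by rewrite mul0r mulr0.
rewrite mul1r -exprD -signr_odd (_ : odd _ = false) //; lia.
Qed.

(** [b + V_n] lies in the Lie algebra of [O(n+1,n)], because [C (b + curv_mx a)] is
    antisymmetric. Indeed [C] sends the subdiagonal [b] to the antidiagonal
    [i + j = 2n - 1], on which its signs alternate, and the two antidiagonals of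
    [curv_mx a] to the two diagonals next to the main one, where [a j] occurs in
    the symmetric positions [(j + 1, j)] and [(j, j + 1)] with opposite signs. *)
Lemma curv_mx_skew (a : nat -> R) :
  (b + curv_mx a)^T *m C + C *m (b + curv_mx a) = 0.
Proof.
rewrite -{1}C_mx_sym -trmx_mul; apply/matrixP => i j.
rewrite [LHS]mxE [X in X + _]mxE !C_mx_mul !mxE !b_mxE /=.
have iN := ltn_ord i; have jN := ltn_ord j.
have -> : (N - j.+1 == i.+1)%N = (i + j + 1 == 2 * n)%N by lia.
have -> : (N - i.+1 == j.+1)%N = (i + j + 1 == 2 * n)%N by lia.
have -> : (N - j.+1 + i + 1 == 2 * n)%N = (j == i.+1 :> nat) by lia.
have -> : (N - i.+1 + j + 1 == 2 * n)%N = (i == j.+1 :> nat) by lia.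
have -> : (N - j.+1 + i == 2 * n + 1)%N = (i == j.+1 :> nat) by lia.
have -> : (N - i.+1 + j == 2 * n + 1)%N = (j == i.+1 :> nat) by lia.
have [ij|ij] := boolP (odd (i + j)); last first.
  have -> : (i + j + 1 == 2 * n)%N = false by apply/eqP => E; move: ij; lia.
  have -> : (i == j.+1 :> nat) = false by apply/eqP => E; move: ij; lia.
  have -> : (j == i.+1 :> nat) = false by apply/eqP => E; move: ij; lia.
  by rewrite !mul0r !addr0 !mulr0 addr0.
have -> : (-1) ^+ (n + j) = - (-1) ^+ (n + i) :> R.
  rewrite -signr_odd -[in RHS]signr_odd !oddD; move: ij; rewrite oddD.
  by case: (odd i); case: (odd j) => //= _; case: (odd n); rewrite /= ?expr0 ?expr1 ?opprK.
rewrite mulNr addrC; apply/eqP; rewrite subr_eq0; apply/eqP; congr (_ * (_ + _)).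
rewrite addrC; congr (_ + _).
  by case: (@eqP _ (j : nat)) => [->|]; rewrite ?mul0r.
by case: (@eqP _ (i : nat)) => [->|]; rewrite ?mul0r.
Qed.

End CurvatureMatrices.

(** * The scalar product and the group O(n+1,n) *)
Section ScalarProduct.
Variables (R : realType) (n : nat).

Local Notation N := (2 * n).+1.
Local Notation C := (@C_mx R n).
Local Notation b := (@b_mx R n).
Local Notation cV := 'cV[R]_N.
Local Notation form := (@Defs.form R n).

Lemma formDl (X Y Z : cV) : form (X + Y) Z = form X Z + form Y Z.
Proof. by rewrite /form linearD /= !mulmxDl mxE. Qed.

Lemma formZl k (X Y : cV) : form (k *: X) Y = k * form X Y.
Proof. by rewrite /form linearZ /= -!scalemxAl mxE. Qed.

Lemma form_sym (X Y : cV) : form X Y = form Y X.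
Proof.
rewrite /form -[in LHS](trmxK (X^T *m C *m Y)) mxE !trmx_mul C_mx_sym trmxK.
by rewrite mulmxA.
Qed.

Lemma formDr (X Y Z : cV) : form X (Y + Z) = form X Y + form X Z.
Proof. by rewrite form_sym formDl !(form_sym X). Qed.

Lemma formZr k (X Y : cV) : form X (k *: Y) = k * form X Y.
Proof. by rewrite form_sym formZl form_sym. Qed.

Lemma form0l (X : cV) : form 0 X = 0.
Proof. by rewrite -(scale0r 0) formZl mul0r. Qed.

Lemma formBl (X Y Z : cV) : form (X - Y) Z = form X Z - form Y Z.
Proof. by rewrite -scaleN1r formDl formZl mulN1r. Qed.

Lemma formBr (X Y Z : cV) : form X (Y - Z) = form X Y - form X Z.
Proof. by rewrite form_sym formBl !(form_sym X). Qed.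

Lemma form_suml I (r : seq I) (P : pred I) (F : I -> cV) Y :
  form (\sum_(i <- r | P i) F i) Y = \sum_(i <- r | P i) form (F i) Y.
Proof. by rewrite (big_morph (form^~ Y) (fun X Z => formDl X Z Y) (form0l Y)). Qed.

Lemma is_derive_form (X Y : R -> cV) (x : R) dX dY :
  is_derive x 1 X dX -> is_derive x 1 Y dY ->
  is_derive x 1 (fun t => form (X t) (Y t)) (form dX (Y x) + form (X x) dY).
Proof.
move=> XD YD; have XTD := is_derive_trmx XD.
have CD : is_derive x 1 (fun _ : R => C) 0 by exact: is_derive_cst.
have /is_derive_mxP/(_ 0 0) := is_derive_mulmx (is_derive_mulmx XTD CD) YD.
by rewrite mulmx0 addr0 mxE.
Qed.

Lemma smooth_form (X Y : R -> cV) :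
  smooth X -> smooth Y -> smooth (fun t => form (X t) (Y t)).
Proof.
move=> Xs Ys.
have Cs : smooth (fun _ : R => C) by exact: smooth_cst.
have := smooth_mulmx (smooth_mulmx (smooth_trmx Xs) Cs) Ys.
by move=> /smooth_mxP; apply.
Qed.

(** The entries of [C_n] as a function of natural numbers counted from 0. *)
Definition gram (k l : nat) : R := (k + l == 2 * n)%N%:R * (-1) ^+ (n + k).

Lemma gram_eq0 k l : (k + l != 2 * n)%N -> gram k l = 0.
Proof. by rewrite /gram => /negbTE ->; rewrite mul0r. Qed.

(** Columns indexed by natural numbers: the frame equations involve the indices
    [2n - 1 - j] and [2n + 1 - j]. *)
Definition ncol (g : 'M[R]_N) (k : nat) : cV := col (inord k) g.

Lemma form_ncol g h k l :
  form (ncol g k) (ncol h l) = (g^T *m C *m h) (inord k) (inord l).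
Proof. by rewrite /form /ncol tr_col -row_mul colE mulmxA -row_mul -colE 2!mxE. Qed.

Lemma O_groupP g : O_group g <->
  forall k l, (k <= 2 * n)%N -> (l <= 2 * n)%N ->
    form (ncol g k) (ncol g l) = gram k l.
Proof.
split=> [gO k l kn ln|H].
  by rewrite form_ncol gO C_mxE !inordK.
apply/matrixP => i j; have := H i j; rewrite form_ncol !inord_val C_mxE; apply.
  by rewrite -ltnS.
by rewrite -ltnS.
Qed.

Lemma O_group_inv g : O_group g -> C *m g^T *m C *m g = 1%:M.
Proof. by move=> gO; rewrite -!mulmxA (mulmxA g^T) gO C_mx_invol. Qed.

(** This form of the group condition is the one that the flow of [g' = g (b + u)]
    visibly preserves. *)
Lemma O_group_trmxP g : O_group g <-> g *m C *m g^T = C.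
Proof.
split=> [/O_group_inv /mulmx1C E|E].
  by rewrite -[RHS]mul1mx -E -!mulmxA C_mx_invol mulmx1.
have E2 : (g *m C *m g^T) *m C = 1%:M by rewrite E C_mx_invol.
have /mulmx1C : g *m (C *m g^T *m C) = 1%:M by rewrite !mulmxA.
move=> E3.
have E4 : C *m (g^T *m C *m g) = 1%:M by rewrite !mulmxA.
by rewrite /O_group /= -[LHS]mul1mx -{1}C_mx_invol -mulmxA E4 mulmx1.
Qed.

Lemma O_group_unit (g : 'M[R]_N) : O_group g -> g \in unitmx.
Proof. by move=> /O_group_inv /mulmx1_unit[]. Qed.

Lemma O_groupM (g h : 'M[R]_N) : O_group g -> O_group h -> O_group (g *m h).
Proof.
move=> gO hO; rewrite /O_group /= trmx_mul.
by rewrite -!mulmxA (mulmxA C) (mulmxA g^T) (mulmxA g^T) gO mulmxA hO.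
Qed.

Lemma O_group_trmx (g : 'M[R]_N) : O_group g -> O_group g^T.
Proof. by move=> /O_group_trmxP E; rewrite /O_group /= trmxK. Qed.

Lemma O_group_C : O_group C.
Proof. by rewrite /O_group /= C_mx_sym C_mx_invol mul1mx. Qed.

Lemma ncolM (A g : 'M[R]_N) k : ncol (A *m g) k = A *m ncol g k.
Proof. by rewrite /ncol !colE mulmxA. Qed.

Lemma ncol_mul g (M : 'M[R]_N) j :
  ncol (g *m M) j = \sum_(k < N) M k (inord j) *: ncol g k.
Proof.
apply/matrixP => i z; rewrite summxE !mxE; apply: eq_bigr => k _.
by rewrite !mxE inord_val mulrC.
Qed.

Lemma ncol_mul_curv g a j : (0 < n)%N -> supported n a -> (j < 2 * n)%N ->
  ncol (g *m (b + curv_mx n a)) j =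
  ncol g j.+1 + a j *: ncol g (2 * n - 1 - j) + a j.-1 *: ncol g (2 * n + 1 - j).
Proof.
move=> n0 a0 jn; apply/matrixP => i z; rewrite ncol_mul summxE !mxE.
rewrite (eq_bigr (fun k : 'I_N => g i (inord k) * (k == j.+1 :> nat)%:R +
   (a j * (g i (inord k) * (k + j + 1 == 2 * n)%N%:R) +
    a j.-1 * (g i (inord k) * (k + j == 2 * n + 1)%N%:R)))) => [|k _]; last first.
  by rewrite !mxE b_mxE !inordK ?inord_val; [ring | lia].
rewrite !big_split -!big_distrr /= addrA; congr (_ + _ * _ + _).
- rewrite (sum_indicator (k0 := j.+1) (fun k => g i (inord k))
    (P := fun k => (k == j.+1)) (Q := true)) ?mul1r //; lia.
- rewrite (sum_indicator (k0 := 2 * n - 1 - j) (fun k => g i (inord k))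
    (P := fun k => (k + j + 1 == 2 * n)%N) (Q := true)) ?mul1r //; lia.
- case: j jn => [|j] jn; first by rewrite a0 ?mul0r //; lia.
  rewrite (sum_indicator (k0 := 2 * n + 1 - j.+1) (fun k => g i (inord k))
    (P := fun k => (k + j.+1 == 2 * n + 1)%N) (Q := true)) ?mul1r //; lia.
Qed.

(** [D = C (A - B)] is antisymmetric with a single nonzero column, the last: its
    entries outside the diagonal vanish by antisymmetry, and so does the last
    diagonal entry. Thus the last column of an element of the Lie algebra is
    determined by the others. *)
Lemma skew_eq (A B : 'M[R]_N) :
  A^T *m C + C *m A = 0 -> B^T *m C + C *m B = 0 ->
  (forall j, (j < 2 * n)%N -> ncol A j = ncol B j) -> A = B.
Proof.
move=> Ask Bsk AB; pose D := C *m (A - B).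
have Dsk i j : D i j = - D j i.
  apply/eqP; rewrite -addr_eq0 addrC; apply/eqP.
  have : (A - B)^T *m C + D = 0.
    by rewrite /D linearB /= mulmxBl mulmxBr addrACA -opprD Ask Bsk subrr.
  by rewrite -{1}C_mx_sym -trmx_mul => /matrixP/(_ i j); rewrite !mxE.
have D0 i (j : 'I_N) : (j < 2 * n)%N -> D i j = 0.
  move=> jn; rewrite C_mx_mul mxE.
  have /matrixP/(_ (rev_ord i) 0) := AB j jn.
  by rewrite !mxE inord_val => ->; rewrite subrr mulr0.
have DD : D = 0.
  apply/matrixP => i j; rewrite [RHS]mxE.
  have [jn|jn] := ltnP j (2 * n); first exact: D0.
  have [in_|in_] := ltnP i (2 * n); first by rewrite Dsk D0 ?oppr0.
  have ij : i = j by apply/val_inj; have := ltn_ord i; have := ltn_ord j; rewrite /=; lia.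
  by have := Dsk j j; rewrite ij; lra.
apply/eqP; rewrite -subr_eq0; apply/eqP.
by rewrite -[LHS]mul1mx -C_mx_invol -mulmxA -/D DD mulmx0.
Qed.

(** A vector can be made null by moving it along a null direction that is not
    orthogonal to it, in exactly one way. This determines the curvatures. *)
Lemma null_correction (w q : cV) (s a : R) :
  form q q = 0 -> form w q = s -> s ^+ 2 = 1 ->
  form (w - a *: q) (w - a *: q) = 0 <-> a = s * form w w / 2.
Proof.
move=> qq wq ss; rewrite !(formBl, formBr, formZl, formZr) (form_sym q) qq wq.
split=> [E|->]; last by field: ss.
have -> : form w w = 2 * (a * s) by lra.
have -> : s * (2 * (a * s)) / 2 = a * s ^+ 2 by field.
by rewrite ss mulr1.
Qed.

End ScalarProduct.

(** * Construction of the moving frame *)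
Section MovingFrame.
Variables (R : realType) (n : nat).
Hypothesis n0 : (0 < n)%N.

Local Notation N := (2 * n).+1.
Local Notation C := (@C_mx R n).
Local Notation b := (@b_mx R n).
Local Notation cV := 'cV[R]_N.
Local Notation form := (@Defs.form R n).

Lemma sign_odd_add (k l : nat) : odd (k + l) -> (-1) ^+ k = - (-1) ^+ l :> R.
Proof.
rewrite oddD -signr_odd -[in RHS]signr_odd.
by case: (odd k); case: (odd l) => //= _; rewrite ?expr0 ?expr1 ?opprK.
Qed.

(** [g' = g (b + curv_mx a)] read on all columns of [g] but the last. *)
Definition frame_equation (c : nat -> R -> cV) (a : nat -> R -> R) : Prop :=
  forall j (x : R), (j < 2 * n)%N -> is_derive x 1 (c j)
    (c j.+1 x + a j x *: c (2 * n - 1 - j)%N x + a j.-1 x *: c (2 * n + 1 - j)%N x).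

(** Differentiate [form (c j) (c l) = gram j l], which is constant, and replace
    the derivatives of [c j] and [c l] by the frame equation. Among the terms that
    involve [a], only two can be nonzero, for [l = j - 1], and they cancel; what
    remains is [form (c j.+1) (c l) = - form (c j) (c l.+1)]. For [l = j] the
    symmetry of the form gives [form (c j)' (c j) = 0]. *)
Lemma gram_step (c : nat -> R -> cV) (a : nat -> R -> R) (j : nat) :
  (forall x, supported n (a^~ x)) -> frame_equation c a ->
  (n <= j.+1)%N -> (j < 2 * n)%N ->
  (forall k l x, (k <= j)%N -> (l <= j)%N -> form (c k x) (c l x) = gram R n k l) ->
  forall l x, (l <= j)%N -> form (c j.+1 x) (c l x) = gram R n j.+1 l.
Proof.
move=> a0 cD nj j2n G l x lj.
have aG i p q : ((n <= i < 2 * n)%N -> (p <= j)%N && (q <= j)%N) ->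
    a i x * form (c p x) (c q x) = a i x * gram R n p q.
  move=> H; case: (boolP (n <= i < 2 * n)%N) => [/H/andP[? ?]|/a0 ->].
    by rewrite G.
  by rewrite !mul0r.
have cst k : (k <= j)%N -> is_derive x 1 (fun t => form (c j t) (c k t)) 0.
  move=> kj; rewrite (_ : (fun t => _) = fun=> gram R n j k).
    exact: is_derive_cst.
  by apply/funext => t; exact: G.
have cj := cD j x j2n.
move: lj; rewrite leq_eqVlt => /predU1P[->|lj].
  have := is_derive_form cj cj; have := cst j (leqnn j).
  move=> /(@derive_val _ _ _ _ _ _ _) + /(@derive_val _ _ _ _ _ _ _) => -> E.
  have {}E : form (c j.+1 x + a j x *: c (2 * n - 1 - j)%N x +
      a j.-1 x *: c (2 * n + 1 - j)%N x) (c j x) = 0.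
    by move: E; rewrite (form_sym (c j x)); lra.
  move: E; rewrite !formDl !formZl !aG; [|lia..].
  rewrite !(@gram_eq0 R n (_ - _)); [|lia..].
  by rewrite !mulr0 !addr0 gram_eq0 //; lia.
have cl := cD l x (ltn_trans lj j2n).
have := is_derive_form cj cl; have := cst l (ltnW lj).
move=> /(@derive_val _ _ _ _ _ _ _) + /(@derive_val _ _ _ _ _ _ _) => -> /esym.
rewrite !(formDl, formDr, formZl, formZr) !aG; [|lia..].
rewrite (G j l.+1) //.
rewrite (@gram_eq0 R n (2 * n - 1 - j)%N); last by lia.
rewrite (@gram_eq0 R n j (2 * n + 1 - l)%N); last by lia.
rewrite !mulr0 !addr0 => E.
have {E} : form (c j.+1 x) (c l x) = - gram R n j l.+1.
  move: E; rewrite /gram.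
  have -> : (2 * n + 1 - j + l == 2 * n)%N = (j == l.+1) by lia.
  have -> : (j + (2 * n - 1 - l) == 2 * n)%N = (j == l.+1) by lia.
  case: eqP => [->|_]; last by rewrite !mul0r !mulr0 !addr0; lra.
  rewrite /= (@sign_odd_add (n + (2 * n + 1 - l.+1))%N (n + l.+1)%N); last by lia.
  lra.
move=> ->; rewrite /gram (@sign_odd_add (n + j.+1) (n + j)); last by lia.
have -> : (j + l.+1 == 2 * n)%N = (j.+1 + l == 2 * n)%N by lia.
by rewrite mulrN.
Qed.

(** The pair of the column of index [n + i] and of the curvature [a (n + i - 1)].
    The frame equation gives the next column up to a multiple of the derivative
    of order [n - 1 - i], and this multiple is the one that makes the column
    null; the sign is the product of that column with that derivative. The initial curvature is 0 because no [beta_i] has its first entry in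
    column [n - 1]; so the derivative of order [n + 1] in the first step has the
    coefficient 0. *)
Fixpoint frame_rec (gamma : R -> cV) (i : nat) : (R -> cV) * (R -> R) :=
  if i is i'.+1 then
    let: (c, a) := frame_rec gamma i' in
    let w x := derive1 c x - a x *: derive1n (n.+1 - i') gamma x in
    let a' x := (-1) ^+ i'.+1 * form (w x) (w x) / 2 in
    (fun x => w x - a' x *: derive1n (n.-1 - i') gamma x, a')
  else (derive1n n gamma, fun=> 0).

Definition frame_col (gamma : R -> cV) (k : nat) : R -> cV :=
  if (k < n)%N then derive1n k gamma else (frame_rec gamma (k - n)).1.

Definition curvature (gamma : R -> cV) (k : nat) : R -> R :=
  if (n <= k < 2 * n)%N then (frame_rec gamma (k - n).+1).2 else fun=> 0.

Lemma frame_rec_col gamma i : (frame_rec gamma i.+1).1 = fun x =>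
  derive1 (frame_rec gamma i).1 x
    - (frame_rec gamma i).2 x *: derive1n (n.+1 - i) gamma x
    - (frame_rec gamma i.+1).2 x *: derive1n (n.-1 - i) gamma x.
Proof. by rewrite /=; case: (frame_rec gamma i). Qed.

Lemma frame_rec_curvature gamma i x : let w :=
    derive1 (frame_rec gamma i).1 x
      - (frame_rec gamma i).2 x *: derive1n (n.+1 - i) gamma x in
  (frame_rec gamma i.+1).2 x = (-1) ^+ i.+1 * form w w / 2.
Proof. by rewrite /=; case: (frame_rec gamma i). Qed.

Lemma smooth_frame_rec gamma i : smooth gamma ->
  smooth (frame_rec gamma i).1 /\ smooth (frame_rec gamma i).2.
Proof.
move=> gs; have gk k : smooth (derive1n k gamma) by exact: smooth_derive1n.
have sub (F G : R -> cV) (f : R -> R) : smooth F -> smooth G -> smooth f ->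
    smooth (fun x => F x - f x *: G x).
  move=> Fs Gs fs.
  rewrite (_ : (fun x => _) = fun x => F x + (-1 * f x) *: G x).
    apply: smooth_addmx; first exact: Fs.
    apply: smooth_scalemx; last exact: Gs.
    by apply: smoothM; [exact: smooth_cst | exact: fs].
  by apply/funext => x; rewrite mulN1r scaleNr.
elim: i => [|i [cs as_]].
  by split; [exact: gk | exact: smooth_cst].
have ws := sub _ _ _ (smooth_derive1 cs) (gk (n.+1 - i)%N) as_.
have a's : smooth (frame_rec gamma i.+1).2.
  rewrite (_ : _.2 = fun x => (-1) ^+ i.+1 / 2 *
     form (derive1 (frame_rec gamma i).1 x
             - (frame_rec gamma i).2 x *: derive1n (n.+1 - i) gamma x)
          (derive1 (frame_rec gamma i).1 x
             - (frame_rec gamma i).2 x *: derive1n (n.+1 - i) gamma x)).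
    by apply: smoothM; [exact: smooth_cst | exact: smooth_form].
  by apply/funext => x; rewrite frame_rec_curvature mulrAC.
split; last exact: a's.
rewrite frame_rec_col; exact: (sub _ _ _ ws (gk _) a's).
Qed.

Lemma frame_col_low gamma k : (k <= n)%N -> frame_col gamma k = derive1n k gamma.
Proof.
rewrite leq_eqVlt => /predU1P[->|kn]; rewrite /frame_col ?kn //.
by rewrite ltnn subnn.
Qed.

Lemma frame_col_high gamma i : frame_col gamma (n + i) = (frame_rec gamma i).1.
Proof. by rewrite /frame_col ltnNge leq_addr addKn. Qed.

Lemma smooth_frame_col gamma k : smooth gamma -> smooth (frame_col gamma k).
Proof.
move=> gs; rewrite /frame_col; case: ifP => _; first exact: smooth_derive1n.
by case: (smooth_frame_rec (k - n) gs).
Qed.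

Lemma smooth_curvature gamma k : smooth gamma -> smooth (curvature gamma k).
Proof.
move=> gs; rewrite /curvature; case: ifP => _; last exact: smooth_cst.
by case: (smooth_frame_rec (k - n).+1 gs).
Qed.

Lemma curvature_supported gamma x : supported n ((curvature gamma)^~ x).
Proof. by move=> j /negbTE nj; rewrite /curvature nj. Qed.

Lemma curvature_pred gamma i : (i <= n)%N ->
  curvature gamma (n + i).-1 = (frame_rec gamma i).2.
Proof.
move=> i_n; rewrite /curvature; case: i i_n => [|i] i_n.
  by rewrite addn0; case: ifP => //; lia.
rewrite addnS /= (_ : (_ <= _ < _)%N = true); last by lia.
by rewrite addKn.
Qed.

Lemma frame_col_equation gamma : smooth gamma ->
  frame_equation (frame_col gamma) (curvature gamma).
Proof.
move=> gs j x j2n; have cs := smooth_is_derive x (@smooth_frame_col gamma j gs).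
suff <- : derive1 (frame_col gamma j) x =
    frame_col gamma j.+1 x + curvature gamma j x *: frame_col gamma (2 * n - 1 - j) x +
    curvature gamma j.-1 x *: frame_col gamma (2 * n + 1 - j) x by [].
have [jn|jn] := ltnP j n.
  rewrite !(@curvature_supported gamma x); [|lia..].
  by rewrite !scale0r !addr0 !frame_col_low ?derive1nS // ltnW.
have [i -> i_n] : exists2 i, j = (n + i)%N & (i < n)%N.
  by exists (j - n)%N; lia.
have aE : curvature gamma (n + i) = (frame_rec gamma i.+1).2.
  by rewrite -curvature_pred // addnS.
have low : (frame_rec gamma i).2 x *: frame_col gamma (2 * n + 1 - (n + i)) x =
    (frame_rec gamma i).2 x *: derive1n (n.+1 - i) gamma x.
  case: i {j2n jn aE} i_n => [|i] i_n; first by rewrite /= !scale0r.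
  by rewrite frame_col_low; [congr (_ *: derive1n _ _ _); lia | lia].
rewrite curvature_pred; last exact: ltnW.
rewrite aE low -addnS !frame_col_high frame_col_low; last by lia.
rewrite (_ : (2 * n - 1 - (n + i) = n.-1 - i)%N); last by lia.
by rewrite frame_rec_col subrK subrK.
Qed.

End MovingFrame.

(** * Existence of the moving frame and uniqueness of the curvature *)
Section FrameTheory.
Variables (R : realType) (n : nat).
Hypothesis n0 : (0 < n)%N.

Local Notation N := (2 * n).+1.
Local Notation C := (@C_mx R n).
Local Notation b := (@b_mx R n).
Local Notation cV := 'cV[R]_N.
Local Notation form := (@Defs.form R n).

Lemma gram_sym k l : gram R n k l = gram R n l k.
Proof.
rewrite /gram (addnC l); case: eqP => [E|_]; last by rewrite !mul0r.
by rewrite -signr_odd -[in RHS]signr_odd; congr (_ * _ ^+ nat_of_bool _); lia.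
Qed.

Lemma M_space_isotropic (gamma : R -> cV) k l x : @M_space R n gamma ->
  (k < n)%N -> (l < n)%N -> form (derive1n k gamma x) (derive1n l gamma x) = 0.
Proof.
move=> [[_ _ /(_ x)[iso _]] _] kn ln.
by apply: iso; apply: memv_span; apply: map_f; rewrite mem_iota.
Qed.

(** The isotropy of the span of the first [n] derivatives starts an induction
    on the number of columns; [gram_step] provides the products of a new column
    with the previous ones. Its square is 1 for the column [n], by the
    normalization of the parameter, and 0 afterwards, by the choice of the
    curvature. *)
Lemma frame_col_gram (gamma : R -> cV) k l x : @M_space R n gamma ->
  (k <= 2 * n)%N -> (l <= 2 * n)%N ->
  form (frame_col gamma k x) (frame_col gamma l x) = gram R n k l.
Proof.
move=> gM kn ln; have gs : smooth gamma by case: gM => -[].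
(* The induction starts from the [n] columns of index at most [n - 1]. *)
suff main d : (n.-1 + d <= 2 * n)%N -> forall k l x,
    (k <= n.-1 + d)%N -> (l <= n.-1 + d)%N ->
    form (frame_col gamma k x) (frame_col gamma l x) = gram R n k l.
  by apply: (main n.+1); lia.
elim: d {k l x kn ln} => [_ k l x kn ln|d IH dn k l x].
  rewrite !frame_col_low ?(M_space_isotropic _ gM) ?gram_eq0 //; lia.
rewrite addnS in dn *; set j := (n.-1 + d)%N in dn IH *.
have G := IH (ltnW dn).
have step l' (y : R) : (l' <= j)%N ->
    form (frame_col gamma j.+1 y) (frame_col gamma l' y) = gram R n j.+1 l'.
  apply: (gram_step n0 (a := curvature gamma)) => //; last by lia.
    by move=> z; exact: curvature_supported.
  exact: frame_col_equation.
have self : form (frame_col gamma j.+1 x) (frame_col gamma j.+1 x) = gram R n j.+1 j.+1.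
  case: d @j dn {IH} G step => [|i] j dn G step.
    have -> : j.+1 = n by rewrite /j; lia.
    rewrite frame_col_low //; have [_ ->] := gM.
    by rewrite /gram addnn -mul2n eqxx mul1r -signr_odd oddM.
  have i_n : (i < n)%N by rewrite /j in dn; lia.
  have jE : j = (n + i)%N by rewrite /j; lia.
  rewrite gram_eq0; last by lia.
  rewrite jE -addnS frame_col_high frame_rec_col.
  have qq : form (derive1n (n.-1 - i) gamma x) (derive1n (n.-1 - i) gamma x) = 0.
    by rewrite (M_space_isotropic _ gM) //; lia.
  apply/(null_correction _ qq (s := (-1) ^+ i.+1)).
  - have := step (n.-1 - i)%N x; rewrite jE -addnS frame_col_high frame_rec_col.
    rewrite frame_col_low; last by lia.
    rewrite formBl formZl qq mulr0 subr0 => ->; last by lia.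
    rewrite /gram (_ : (_ == _) = true); last by lia.
    rewrite mul1r addnA exprD (_ : (-1) ^+ (n + n) = 1) ?mul1r //.
    by rewrite -signr_odd addnn odd_double.
  - by rewrite -exprM mulnC exprM sqrrN !expr1n.
  - exact: frame_rec_curvature.
rewrite leq_eqVlt => /predU1P[->|kj]; rewrite leq_eqVlt => /predU1P[->|lj].
- exact: self.
- exact: step.
- by rewrite form_sym step // gram_sym.
- exact: G.
Qed.

Lemma is_derive_ncol (g : R -> 'M[R]_N) (x : R) D k :
  is_derive x 1 g D -> is_derive x 1 (fun t => ncol (g t) k) (ncol D k).
Proof.
move=> /is_derive_mxP gD; apply/is_derive_mxP => i j; rewrite mxE.
by rewrite (_ : (fun t => _) = fun t => g t i (inord k)) //; apply/funext => t; rewrite mxE.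
Qed.

(** [g^-1 g'] and [b + curv_mx a] are in the Lie algebra and agree outside the
    last column. *)
Lemma frame_derivative (g : R -> 'M[R]_N) (a : nat -> R -> R) (x : R) :
  smooth g -> (forall x, O_group (g x)) -> (forall x, supported n (a^~ x)) ->
  frame_equation (fun k t => ncol (g t) k) a ->
  derive1 g x = g x *m (b + curv_mx n (a^~ x)).
Proof.
move=> gs gO a0 gE; have gD := smooth_is_derive x gs.
have skew : (derive1 g x)^T *m C *m g x + (g x)^T *m C *m derive1 g x = 0.
  have CD : is_derive x 1 (fun _ : R => C) 0 by exact: is_derive_cst.
  have := is_derive_mulmx (is_derive_mulmx (is_derive_trmx gD) CD) gD.
  rewrite mulmx0 addr0 (_ : (fun t => _) = fun=> C); last by apply/funext => t; exact: gO.
  by move=> /(@derive_val _ _ _ _ _ _ _) <-; rewrite derive_cst.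
have inv : g x *m (C *m (g x)^T *m C) = 1%:M.
  by have /O_group_inv/mulmx1C := gO x.
suff <- : C *m (g x)^T *m C *m derive1 g x = b + curv_mx n (a^~ x).
  by rewrite mulmxA inv mul1mx.
apply: skew_eq; last 1 first.
- move=> j jn; rewrite -[curv_mx _ _]/(curv_mx n (a^~ x)).
  have := is_derive_ncol j gD => /(@derive_val _ _ _ _ _ _ _).
  have := gE j x jn => /(@derive_val _ _ _ _ _ _ _) ->.
  rewrite -(ncol_mul_curv _ n0 (a0 x) jn) => E.
  rewrite /ncol colE -mulmxA -colE -[col _ _]/(ncol _ _) -E /ncol.
  by rewrite colE !mulmxA (O_group_inv (gO x)) mul1mx -colE.
- rewrite !trmx_mul trmxK C_mx_sym -!mulmxA C_mx_invol !mulmxA mulmx1 C_mx_invol mul1mx.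
  exact: skew.
- exact: curv_mx_skew.
Qed.

Lemma smooth_curv_mx (a : nat -> R -> R) : (forall k, smooth (a k)) ->
  smooth (fun x => curv_mx n (a^~ x)).
Proof.
move=> as_; apply/smooth_mxP => i j.
rewrite (_ : (fun t => _) = fun t => (i + j + 1 == 2 * n)%N%:R * a j t +
   (i + j == 2 * n + 1)%N%:R * a j.-1 t); last by apply/funext => t; rewrite mxE.
by apply: smoothD; apply: smoothM; [exact: smooth_cst|exact: as_|exact: smooth_cst|exact: as_].
Qed.

Lemma frame_curvatureE (g : R -> 'M[R]_N) x M : O_group (g x) ->
  derive1 g x = g x *m (b + M) <-> frame_curvature g x = M.
Proof.
move=> gO; have gU := O_group_unit gO; rewrite /frame_curvature; split=> [->|<-].
  by rewrite mulKmx // addrC addKr.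
by rewrite addrC subrK mulKVmx.
Qed.

Lemma moving_frame_exists (gamma : R -> cV) : @M_space R n gamma ->
  exists g, isotropic_moving_frame gamma g.
Proof.
move=> gM; have gs : smooth gamma by case: gM => -[].
pose g x : 'M[R]_N := \matrix_(i, j) frame_col gamma j x i 0.
have gcol k x : (k <= 2 * n)%N -> ncol (g x) k = frame_col gamma k x.
  by move=> kn; apply/matrixP => i j; rewrite !mxE inordK // (ord1 j).
have gO x : O_group (g x).
  by apply/O_groupP => k l kn ln; rewrite !gcol // frame_col_gram.
have g_smooth : smooth g.
  apply/smooth_mxP => i j; have := @smooth_frame_col R n gamma j gs.
  move=> /smooth_mxP/(_ i 0).
  by rewrite (_ : (fun t => g t i j) = fun t => frame_col gamma j t i 0) //;
    apply/funext => t; rewrite mxE.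
have as_ x : supported n ((curvature gamma)^~ x) by exact: curvature_supported.
have gE : frame_equation (fun k t => ncol (g t) k) (curvature gamma).
  move=> j x jn; rewrite (_ : (fun t => _) = frame_col gamma j); last first.
    by apply/funext => t; rewrite gcol // ltnW.
  have := frame_col_equation n0 gs x jn.
  have -> : curvature gamma j.-1 x *: ncol (g x) (2 * n + 1 - j) =
      curvature gamma j.-1 x *: frame_col gamma (2 * n + 1 - j) x.
    (* For [j = 0] the index is out of range and the coefficient is zero. *)
    case: j jn => [|j] jn; last by rewrite gcol //; lia.
    by rewrite as_ ?scale0r //=; lia.
  by rewrite !gcol //; lia.
have curvE : frame_curvature g = fun x => curv_mx n ((curvature gamma)^~ x).
  apply/funext => x; apply/frame_curvatureE => //; exact: frame_derivative.
exists g; split; [exact: g_smooth | exact: gO | |].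
- move=> i x i_n; rewrite -frame_col_low // -gcol; last by rewrite -ltnS.
  by rewrite /ncol inord_val.
- rewrite /smooth_V /= curvE; split=> [|x].
    by apply: smooth_curv_mx => k; exact: smooth_curvature.
  by apply/V_spaceP; exists ((curvature gamma)^~ x).
Qed.

Lemma smooth_V_coef (u : R -> 'M[R]_N) : @smooth_V R n u ->
  exists a : nat -> R -> R, (forall x, supported n (a^~ x)) /\
    u = fun x => curv_mx n (a^~ x).
Proof.
move=> [_ uV].
have coef x : exists a, supported n a /\ u x = curv_mx n a.
  by have /V_spaceP[a a0 ->] := uV x; exists a.
exists (fun k x => sval (cid (coef x)) k); split=> [x|].
  by case: cid => a [].
by apply/funext => x; case: cid => a [].
Qed.

Lemma frame_equation_of_ode (g : R -> 'M[R]_N) (a : nat -> R -> R) :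
  (forall x, supported n (a^~ x)) ->
  (forall x : R, is_derive x 1 g (g x *m (b + curv_mx n (a^~ x)))) ->
  frame_equation (fun k t => ncol (g t) k) a.
Proof.
move=> a0 gD j x jn; have := is_derive_ncol j (gD x).
by rewrite ncol_mul_curv.
Qed.

(** Let [g] be any moving frame and [a] its curvatures. As the next column of [g]
    is null, [null_correction] forces both [a] and this column to be the ones
    that [frame_rec] produces. *)
Lemma moving_frame_curvature (gamma : R -> cV) (g : R -> 'M[R]_N) :
  isotropic_moving_frame gamma g ->
  frame_curvature g = fun x => curv_mx n ((curvature gamma)^~ x).
Proof.
move=> [gs gO glow /smooth_V_coef[a [a0 uE]]].
have gE : frame_equation (fun k t => ncol (g t) k) a.
  apply: frame_equation_of_ode => // x.
  have := smooth_is_derive x gs; congr is_derive.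
  by apply/frame_curvatureE => //; rewrite uE.
have low k x : (k <= n)%N -> ncol (g x) k = derive1n k gamma x.
  move=> kn; have kE : (inord k : 'I_N) = k :> nat by rewrite inordK //; lia.
  by rewrite /ncol glow kE.
have main i : (i <= n)%N -> (forall x, ncol (g x) (n + i) = (frame_rec gamma i).1 x) /\
    forall x, a (n + i).-1 x = (frame_rec gamma i).2 x.
  elim: i => [_|i IH i_n].
    by rewrite addn0; split=> x; [rewrite low | rewrite a0 //=; lia].
  have [IH1 IH2] := IH (ltnW i_n).
  have aS x : a (n + i.+1).-1 x = (frame_rec gamma i.+1).2 x /\
     ncol (g x) (n + i.+1) = derive1 (frame_rec gamma i).1 x
      - (frame_rec gamma i).2 x *: derive1n (n.+1 - i) gamma x
      - a (n + i.+1).-1 x *: derive1n (n.-1 - i) gamma x.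
    have jn : (n + i < 2 * n)%N by lia.
    have := gE (n + i)%N x jn => /derive1_val.
    rewrite (_ : (fun t => ncol (g t) (n + i)) = (frame_rec gamma i).1); last first.
      exact/funext.
    have lowE : a (n + i).-1 x *: ncol (g x) (2 * n + 1 - (n + i)) =
       (frame_rec gamma i).2 x *: derive1n (n.+1 - i) gamma x.
      rewrite IH2; case: i i_n {IH IH1 IH2 jn} => [|i] i_n; first by rewrite /= !scale0r.
      by rewrite low; [congr (_ *: derive1n _ _ _); lia | lia].
    rewrite lowE (_ : (2 * n - 1 - (n + i) = n.-1 - i)%N); last by lia.
    rewrite (low (n.-1 - i)%N); last by lia.
    rewrite addnS /= => E.
    have colE : ncol (g x) (n + i).+1 = derive1 (frame_rec gamma i).1 x
        - (frame_rec gamma i).2 x *: derive1n (n.+1 - i) gamma x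
        - a (n + i)%N x *: derive1n (n.-1 - i) gamma x.
      by rewrite E !addrK.
    split; last exact: colE.
    have gx := (O_groupP (g x)).1 (gO x).
    have qE : ncol (g x) (n.-1 - i) = derive1n (n.-1 - i) gamma x by rewrite low //; lia.
    have qq : form (derive1n (n.-1 - i) gamma x) (derive1n (n.-1 - i) gamma x) = 0.
      by rewrite -qE gx ?gram_eq0 //; lia.
    rewrite -[LHS]/(a (n + i)%N x) frame_rec_curvature.
    apply/(null_correction _ qq (s := (-1) ^+ i.+1)).
    - have := gx (n + i).+1 (n.-1 - i)%N; rewrite colE qE formBl formZl qq mulr0 subr0.
      move=> ->; [|lia..].
      rewrite /gram (_ : (_ == _) = true); last by lia.
      rewrite mul1r -addnS addnA exprD (_ : (-1) ^+ (n + n) = 1) ?mul1r //.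
      by rewrite -signr_odd addnn odd_double.
    - by rewrite -exprM mulnC exprM sqrrN !expr1n.
    - by rewrite -colE gx ?gram_eq0 //; lia.
  split=> x; have [aE cE] := aS x; last exact: aE.
  by rewrite cE aE frame_rec_col.
rewrite uE; apply/funext => x; congr curv_mx; apply/funext => k.
rewrite /curvature; case: ifP => [kn|/negbT]; last exact: a0.
have [_ /(_ x)] := main (k - n).+1 ltac:(lia).
by rewrite addnS /= subnKC //; lia.
Qed.

Lemma Psi_moving_frame (gamma : R -> cV) (g : R -> 'M[R]_N) :
  isotropic_moving_frame gamma g -> Psi gamma = frame_curvature g.
Proof.
move=> gF; have mF : isotropic_moving_frame gamma (moving_frame gamma).
  exact: (@xgetPex _ (cst 1%:M) (isotropic_moving_frame gamma)) (ex_intro _ g gF).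
by rewrite /Psi (moving_frame_curvature mF) (moving_frame_curvature gF).
Qed.

End FrameTheory.

(** * Curves with a prescribed curvature *)
Section FramedCurves.
Variables (R : realType) (n : nat).
Hypothesis n0 : (0 < n)%N.

Local Notation N := (2 * n).+1.
Local Notation C := (@C_mx R n).
Local Notation b := (@b_mx R n).
Local Notation cV := 'cV[R]_N.
Local Notation form := (@Defs.form R n).

Lemma ncol_expand (g : 'M[R]_N) (X : cV) : O_group g ->
  X = \sum_(k < N) ((-1) ^+ (n + k) * form (ncol g (2 * n - k)) X) *: ncol g k.
Proof.
move=> gO; have inv : g *m (C *m g^T *m C) = 1%:M.
  by have /O_group_inv/mulmx1C := gO.
rewrite -[LHS]mul1mx -inv -mulmxA; apply/matrixP => i z.
rewrite summxE mxE; apply: eq_bigr => k _.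
rewrite [RHS]mxE [in RHS]/ncol [X in _ = _ * X]mxE inord_val [RHS]mulrC; congr (_ * _).
rewrite -!mulmxA C_mx_mul (ord1 z); congr (_ * _).
rewrite /Defs.form tr_col -!row_mul [RHS]mxE -mulmxA; congr (_ _ _).
by have kN := ltn_ord k; apply/val_inj; rewrite /= inordK; lia.
Qed.

Lemma form_span0 (m : nat) (F : nat -> cV) (X Y : cV) :
  (forall i, (i < m)%N -> form (F i) Y = 0) ->
  X \in <<mkseq F m>>%VS -> form X Y = 0.
Proof.
move=> FY; pose T := Tuple (introT eqP (size_mkseq F m)).
rewrite -[mkseq F m]/(tval T) => /coord_span ->.
rewrite form_suml big1 // => i _; rewrite formZl nth_mkseq // FY ?mulr0 //.
Qed.

(** The first column of a solution of [g' = g (b + u)] in [O(n+1,n)]. *)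
Section Frame.
Variables (g : R -> 'M[R]_N) (a : nat -> R -> R).
Hypothesis g_smooth : smooth g.
Hypothesis gO : forall x, O_group (g x).
Hypothesis a0 : forall x, supported n (a^~ x).
Hypothesis gD : forall x : R, is_derive x 1 g (g x *m (b + curv_mx n (a^~ x))).

Let gamma (x : R) : cV := ncol (g x) 0.

Let gE : frame_equation (fun k t => ncol (g t) k) a.
Proof. exact: frame_equation_of_ode. Qed.

Lemma framed_smooth : smooth gamma.
Proof.
apply/smooth_mxP => i z; move/smooth_mxP: g_smooth => /(_ i (inord 0)).
rewrite (_ : (fun t => gamma t i z) = fun t => g t i (inord 0)) //.
by apply/funext => t; rewrite mxE.
Qed.

Lemma framed_derive1n k x : (k <= n)%N -> derive1n k gamma x = ncol (g x) k.
Proof.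
elim: k x => [//|k IH] x kn; rewrite derive1nS.
rewrite (_ : derive1n k gamma = fun t => ncol (g t) k); last first.
  by apply/funext => t; apply: IH; exact: ltnW.
have /derive1_val -> := gE x (ltac:(lia) : (k < 2 * n)%N).
by rewrite !a0 ?scale0r ?addr0 //; lia.
Qed.

(** Induction on [k], by differentiating the zero function
    [form (derive1n k gamma) (ncol g l)]: the curvature terms of the derivative of
    [ncol g l] involve columns of index at most [l], on which the pairing with the
    [k]-th derivative is already known to vanish. *)
Lemma framed_pairing k l x : (k + l <= 2 * n)%N ->
  form (derive1n k gamma x) (ncol (g x) l) = gram R n k l.
Proof.
elim: k l x => [|k IH] l x kl.
  by rewrite /= ((O_groupP (g x)).1 (gO x)).
have kD := smooth_is_derive x (@smooth_derive1n R _ _ k framed_smooth).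
have lD := gE x (ltac:(lia) : (l < 2 * n)%N).
have := is_derive_form kD lD.
rewrite (_ : (fun t => form _ _) = fun=> 0); last first.
  by apply/funext => t; rewrite IH ?gram_eq0 //; lia.
move=> /(@derive_val _ _ _ _ _ _ _); rewrite derive_cst -derive1nS.
rewrite !(formDr, formZr) (IH l.+1); last by lia.
have z i m : ((n <= i < 2 * n)%N -> (k + m < 2 * n)%N) ->
    a i x * form (derive1n k gamma x) (ncol (g x) m) = 0.
  move=> H; case: (boolP (n <= i < 2 * n)%N) => [/H km|/a0 ->]; last by rewrite mul0r.
  by rewrite IH ?gram_eq0 ?mulr0 //; lia.
rewrite !z ?addr0; [|lia..] => /esym/eqP; rewrite addr_eq0 => /eqP ->.
rewrite /gram (@sign_odd_add R (n + k.+1) (n + k)); last by lia.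
have -> : (k + l.+1 == 2 * n)%N = (k.+1 + l == 2 * n)%N by lia.
by rewrite mulrN.
Qed.

(** The matrix of the pairings of the derivatives of [gamma] with the columns of
    [g] is triangular with respect to the antidiagonal, with signs on it. *)
Lemma framed_free x : free (mkseq (fun i => derive1n i gamma x) N).
Proof.
pose T := Tuple (introT eqP (size_mkseq (fun i => derive1n i gamma x) N)).
rewrite -[mkseq _ N]/(tval T); apply/freeP => k kT.
have pair l : (l <= 2 * n)%N ->
    \sum_(i < N) k i * form (derive1n i gamma x) (ncol (g x) l) = 0.
  move=> ln; transitivity (form 0 (ncol (g x) l)); last exact: form0l.
  rewrite -kT form_suml.
  by apply: eq_bigr => i _; rewrite formZl nth_mkseq.
have main l : (l <= 2 * n)%N -> k (inord (2 * n - l)) = 0.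
  elim/ltn_ind: l => l IH ln; have := pair l ln.
  rewrite (bigD1 (inord (2 * n - l))) //= big1 => [|i il]; last first.
    have [iln|iln] := ltnP (i + l) (2 * n).
      by rewrite framed_pairing ?gram_eq0 ?mulr0 //; lia.
    have iN := ltn_ord i.
    have ne : (i : nat) <> (2 * n - l)%N.
      by move=> E; move/eqP: il; apply; apply/val_inj; rewrite /= inordK // ; lia.
    have -> : i = inord (2 * n - (2 * n - i)).
      by apply/val_inj; rewrite /= inordK; lia.
    by rewrite IH ?mul0r //; lia.
  rewrite addr0 inordK; last by lia.
  rewrite framed_pairing; last by lia.
  move=> /eqP; rewrite mulf_eq0 => /orP[/eqP //|].
  by rewrite /gram subnK // eqxx mul1r signr_eq0.
move=> i; have iN := ltn_ord i; rewrite -(main (2 * n - i)%N); last by lia.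
by congr k; apply/val_inj; rewrite /= inordK; lia.
Qed.

(** Let [X] be in an isotropic space containing the first [n] columns. The
    orthogonality to these kills the coordinates of [X] of index above [n], and
    then [form X X] is, up to sign, the square of the coordinate of index [n]. *)
Lemma framed_maximal x :
  maximal_isotropic <<mkseq (fun i => derive1n i gamma x) n>>%VS.
Proof.
have gx := (O_groupP (g x)).1 (gO x).
split=> [X Y XW YW|W' isoW' WW'].
  apply: form_span0 XW => i i_n; rewrite form_sym; apply: form_span0 YW => j jn.
  by rewrite !framed_derive1n ?gx ?gram_eq0 //; lia.
apply/eqP; rewrite eqEsubv WW' andbT; apply/subvP => X XW'.
have colW k : (k < n)%N -> ncol (g x) k \in <<mkseq (fun i => derive1n i gamma x) n>>%VS.
  move=> kn; rewrite -framed_derive1n ?(ltnW kn) //.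
  by apply: memv_span; apply: map_f; rewrite mem_iota.
have low k : (k < n)%N -> form (ncol (g x) k) X = 0.
  by move=> kn; apply: isoW' => //; apply: (subvP WW'); exact: colW.
have XE := ncol_expand X (gO x).
have mid : form (ncol (g x) n) X = 0.
  have : form X X = 0 by exact: isoW'.
  rewrite {1}XE form_suml (bigD1 (inord n)) //= big1 => [|k kn]; last first.
    rewrite formZl; have kN := ltn_ord k.
    have ne : (k : nat) <> n.
      by move=> E; move/eqP: kn; apply; apply/val_inj; rewrite /= inordK // ; lia.
    have [k_n|k_n] := ltnP k n; first by rewrite (low k) ?mulr0.
    by rewrite low ?mulr0 ?mul0r //; lia.
  rewrite addr0 inordK; last by lia.
  rewrite formZl (_ : (2 * n - n)%N = n); last by lia.
  by rewrite -mulrA => /eqP; rewrite !mulf_eq0 signr_eq0 orbb => /eqP.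
rewrite XE; apply: memv_suml => k _; have kN := ltn_ord k.
have [kn|kn] := ltnP k n; first by apply: memvZ; exact: colW.
suff -> : form (ncol (g x) (2 * n - k)) X = 0 by rewrite mulr0 scale0r mem0v.
move: kn; rewrite leq_eqVlt => /predU1P[kn|kn]; last by apply: low; lia.
by rewrite -kn (_ : (2 * n - n)%N = n) //; lia.
Qed.

Lemma framed_curve_M_space : @M_space R n gamma.
Proof.
split; first split.
- exact: framed_smooth.
- exact: framed_free.
- exact: framed_maximal.
- move=> x; rewrite framed_derive1n // ((O_groupP (g x)).1 (gO x)); [|lia..].
  by rewrite /gram addnn -mul2n eqxx mul1r -signr_odd oddM.
Qed.

End Frame.

Lemma framed_curve (u g : R -> 'M[R]_N) : @smooth_V R n u -> smooth g ->
  (forall x, O_group (g x)) ->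
  (forall x : R, is_derive x 1 g (g x *m (b + u x))) ->
  @M_space R n (fun x => ncol (g x) 0) /\ Psi (fun x => ncol (g x) 0) = u.
Proof.
move=> uV gs gO gD; have [a [a0 uE]] := smooth_V_coef uV.
have gD' (x : R) : is_derive x 1 g (g x *m (b + curv_mx n (a^~ x))).
  by have := gD x; rewrite uE.
have curvE : frame_curvature g = u.
  apply/funext => x; apply/frame_curvatureE; first exact: gO.
  exact: derive1_val (gD x).
split; first exact: framed_curve_M_space gs gO a0 gD'.
rewrite -curvE; apply: (Psi_moving_frame n0).
split; [exact: gs | exact: gO | move=> i x i_n | rewrite curvE; exact: uV].
by rewrite (framed_derive1n a0 gD' _ i_n) /ncol inord_val.
Qed.

Lemma moving_frameP (gamma : R -> cV) : @M_space R n gamma ->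
  isotropic_moving_frame gamma (moving_frame gamma).
Proof.
move=> /(moving_frame_exists n0) [g gF].
exact: (@xgetPex _ (cst 1%:M) (isotropic_moving_frame gamma)) (ex_intro _ g gF).
Qed.

Lemma ode_generator_skew (u : 'M[R]_N) : u \in @V_space R n ->
  (b + u) *m C + C *m (b + u)^T = 0.
Proof.
move=> /V_spaceP[a _ ->]; have E := curv_mx_skew n a.
move: (b + _) E => M E.
have : C *m (M^T *m C + C *m M) *m C = 0 by rewrite E mulmx0 mul0mx.
rewrite mulmxDr mulmxDl -!mulmxA C_mx_invol mulmx1 !mulmxA C_mx_invol mul1mx.
by rewrite addrC.
Qed.

(** For [h = g] this says that the flow preserves [O(n+1,n)]; for two solutions in
    the group it says that they differ by a constant left factor, because
    [h^-1 = C h^T C]. *)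
Lemma ode_product_cst (u g h : R -> 'M[R]_N) : @smooth_V R n u ->
  (forall x : R, is_derive x 1 g (g x *m (b + u x))) ->
  (forall x : R, is_derive x 1 h (h x *m (b + u x))) ->
  forall x y, g x *m C *m (h x)^T = g y *m C *m (h y)^T.
Proof.
move=> [_ uV] gD hD; apply: zero_derivative_mx => x.
have CD : is_derive x 1 (fun _ : R => C) 0 by exact: is_derive_cst.
have := is_derive_mulmx (is_derive_mulmx (gD x) CD) (is_derive_trmx (hD x)).
rewrite mulmx0 addr0 trmx_mul; congr is_derive.
rewrite !mulmxA -mulmxDl -!(mulmxA (g x)) -mulmxDr.
by rewrite ode_generator_skew // mulmx0 mul0mx.
Qed.

Lemma frame_ode_exists (u : R -> 'M[R]_N) : @smooth_V R n u ->
  exists g : R -> 'M[R]_N, [/\ smooth g, forall x, O_group (g x) &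
    forall x : R, is_derive x 1 g (g x *m (b + u x))].
Proof.
move=> uV; have [us _] := uV.
have bus : smooth (fun x => b + u x).
  by apply: smooth_addmx us; exact: smooth_cst.
have [|g [g0 gD]] := @linear_matrix_ode R N (fun x => b + u x) 1%:M.
  by move=> i j; apply: smooth_continuous; move/smooth_mxP: bus; exact.
exists g; split; [exact: smooth_ode_solution bus gD | | exact: gD].
move=> x; apply/O_group_trmxP; rewrite (ode_product_cst uV gD gD x 0) g0.
by rewrite mul1mx trmx1 mulmx1.
Qed.

End FramedCurves.

Theorem proposition2p4 (R : realType) (n : nat) (hn : (1 <= n)%N) :
  [/\ set_fun (@M_space R n) (@smooth_V R n) (@Psi R n),
      set_surj (@M_space R n) (@smooth_V R n) (@Psi R n) &
      forall u : R -> 'M[R]_((2 * n).+1), @smooth_V R n u ->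
        exists2 gamma0 : R -> 'cV[R]_((2 * n).+1), @M_space R n gamma0 &
          @M_space R n `&` @Psi R n @^-1` [set u] = @O_orbit R n gamma0].
Proof.
split=> [gamma gM|u uV|u uV].
- by have [] := moving_frameP hn gM.
- have [g [gs gO gD]] := frame_ode_exists uV.
  have [gM gPsi] := framed_curve hn uV gs gO gD.
  by exists (fun x => ncol (g x) 0).
have [g [gs gO gD]] := frame_ode_exists uV.
have [gM gPsi] := framed_curve hn uV gs gO gD.
exists (fun x => ncol (g x) 0) => //; apply/seteqP; split=> [gamma [gammaM Psiu]|_ [A AO <-]].
  have [hs hO hlow _] := moving_frameP hn gammaM.
  set h := moving_frame gamma in hs hO hlow.
  have hD (x : R) : is_derive x 1 h (h x *m (b_mx R n + u x)).
    have := smooth_is_derive x hs; congr is_derive.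
    by apply/frame_curvatureE => //; rewrite -Psiu.
  (* This matrix is [h 0 *m invmx (g 0)]. *)
  exists (h 0 *m C_mx R n *m (g 0)^T *m C_mx R n).
    by do 3?[apply: O_groupM]; [exact: hO | exact: O_group_C |
      exact/O_group_trmx/gO | exact: O_group_C].
  apply/funext => x; rewrite /act (ode_product_cst uV hD gD 0 x) -ncolM.
  rewrite -!mulmxA; have := O_group_inv (gO x); rewrite -!mulmxA => ->.
  rewrite mulmx1 -[RHS]/(derive1n 0 gamma x) -(hlow 0) //.
  by rewrite /ncol (_ : inord 0 = 0) //; apply/val_inj; rewrite /= inordK.
have AgD (x : R) : is_derive x 1 (fun t => A *m g t) (A *m g x *m (b_mx R n + u x)).
  have AD : is_derive x 1 (fun _ : R => A) 0 by exact: is_derive_cst.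
  by have := is_derive_mulmx AD (gD x); rewrite mul0mx add0r mulmxA.
have Ags : smooth (fun t => A *m g t).
  by apply: smooth_mulmx gs; exact: smooth_cst.
have AgO x : O_group (A *m g x) by exact: O_groupM.
have [AgM AgPsi] := framed_curve hn uV Ags AgO AgD.
rewrite (_ : act A _ = fun x => ncol (A *m g x) 0) //.
by apply/funext => x; rewrite /act ncolM.
Qed.
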